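(* Let $G$ be a finite group admitting an admissible epimorphism $\varphi\colon \mathsf P_2(\Sigma_b)\to G$, where $b\ge 2$. Then $|G|\ge 32$, with equality if and only if $G$ is extra-special. Moreover, the following holds. (1) For both extra-special groups $G$ of order $32$, there are $2211840=1152\cdot1920$ admissible epimorphisms $\varphi\colon\mathsf P_2(\Sigma_2)\to G$. For all of them, $\varphi(A_{12})$ is the generator of $Z(G)$, so the order $n$ of $\varphi(A_{12})$ is $n=2$. (2) If $G=G(32,49)=\mathsf{H}_5(\mathbb Z_2)$, these epimorphisms form $1920$ orbits under the natural action of $\operatorname{Aut}(G)$. (3) If $G=G(32,50)=\mathsf{G}_5(\mathbb Z_2)$, these epimorphisms form $1152$ orbits under the natural action of $\operatorname{Aut}(G)$.
   Context: Conventions: $[x,y]=xyx^{-1}y^{-1}$; $Z(G)$ is the center of $G$; $G(m,t)$ is the group of label $(m,t)$ in the GAP small groups library. Let $\Sigma_b$ be a closed Riemann surface of genus $b\ge 2$ and $\Delta\subset\Sigma_b\times\Sigma_b$ the diagonal. $\mathsf P_2(\Sigma_b)$ is the pure braid group of genus $b$ on two strands, isomorphic to $\pi_1(\Sigma_b\times\Sigma_b-\Delta)$. The element $A_{12}$ corresponds to the homotopy class in $\Sigma_b\times\Sigma_b-\Delta$ of a loop winding once around $\Delta$. By Gonçalves–Guaschi, $\mathsf P_2(\Sigma_b)$ has a presentation with the $4b+1$ generators $\rho_{11},\tau_{11},\ldots,\rho_{1b},\tau_{1b},\rho_{21},\tau_{21},\ldots,\rho_{2b},\tau_{2b},A_{12}$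 and the following relations (for all $j,k\in\{1,\dots,b\}$). Surface relations: $$[\rho_{1b}^{-1},\tau_{1b}^{-1}]\tau_{1b}^{-1}[\rho_{1,b-1}^{-1},\tau_{1,b-1}^{-1}]\tau_{1,b-1}^{-1}\cdots[\rho_{11}^{-1},\tau_{11}^{-1}]\tau_{11}^{-1}(\tau_{11}\tau_{12}\cdots\tau_{1b})=A_{12},$$ $$[\rho_{21}^{-1},\tau_{21}]\tau_{21}[\rho_{22}^{-1},\tau_{22}]\tau_{22}\cdots[\rho_{2b}^{-1},\tau_{2b}]\tau_{2b}(\tau_{2b}^{-1}\tau_{2,b-1}^{-1}\cdots\tau_{21}^{-1})=A_{12}^{-1}.$$ Conjugacy action of $\rho_{1j}$: $[\rho_{1j},\rho_{2k}]=1$ if $j<k$; $[\rho_{1j},\rho_{2j}]=1$; $[\rho_{1j},\rho_{2k}]=A_{12}^{-1}\rho_{2k}\rho_{2j}^{-1}A_{12}\rho_{2j}\rho_{2k}^{-1}$ if $j>k$; $[\rho_{1j},\tau_{2k}]=1$ if $j<k$; $[\rho_{1j},\tau_{2j}]=A_{12}^{-1}$; $[\rho_{1j},\tau_{2k}]=[A_{12}^{-1},\tau_{2k}]$ if $j>k$; $[\rho_{1j},A_{12}]=[\rho_{2j}^{-1},A_{12}]$. Conjugacy action of $\tau_{1j}$: $[\tau_{1j},\rho_{2k}]=1$ if $j<k$; $[\tau_{1j},\rho_{2j}]=\tau_{2j}^{-1}A_{12}\tau_{2j}$; $[\tau_{1j},\rho_{2k}]=[\tau_{2j}^{-1},A_{12}]$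 if $j>k$; $[\tau_{1j},\tau_{2k}]=1$ if $j<k$; $[\tau_{1j},\tau_{2j}]=[\tau_{2j}^{-1},A_{12}]$; $[\tau_{1j},\tau_{2k}]=\tau_{2j}^{-1}A_{12}\tau_{2j}A_{12}^{-1}\tau_{2k}A_{12}\tau_{2j}^{-1}A_{12}^{-1}\tau_{2j}\tau_{2k}^{-1}$ if $j>k$; $[\tau_{1j},A_{12}]=[\tau_{2j}^{-1},A_{12}]$. A group epimorphism $\varphi\colon\mathsf P_2(\Sigma_b)\to G$ is admissible if $\varphi(A_{12})\ne 1$. The group $\operatorname{Aut}(G)$ acts on such epimorphisms by post-composition. A finite $p$-group $G$ is extra-special if $Z(G)$ is cyclic of order $p$ and $G/Z(G)$ is a non-trivial elementary abelian $p$-group. Up to isomorphism there are exactly two extra-special groups of order $32$: $\mathsf{H}_5(\mathbb Z_2)=\langle r_1,t_1,r_2,t_2,z\mid r_j^2=t_j^2=z^2=1,\ [r_j,z]=[t_j,z]=1,\ [r_j,r_k]=[t_j,t_k]=1,\ [r_j,t_k]=z^{-\delta_{jk}}\rangle$, and $\mathsf{G}_5(\mathbb Z_2)=\langle r_1,t_1,r_2,t_2,z\mid r_1^2=t_1^2=z^2=1,\ r_2^2=t_2^2=z,\ [r_j,z]=[t_j,z]=1,\ [r_j,r_k]=[t_j,t_k]=1,\ [r_j,t_k]=z^{-\delta_{jk}}\rangle$ (indices in $\{1,2\}$, $\delta_{jk}$ the Kronecker symbol).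
   Formalization: ''Equality iff G is extra-special'' is read as: a group of order 32 admits an admissible epimorphism for some b ≥ 2 iff it is extra-special. Literally the converse fails, since an extra-special group of order 128 admits one for b = 2. *)

(* Defs.v *)
From HB Require Import structures.
From mathcomp Require Import all_boot all_fingroup all_solvable.
From mathcomp Require Import boolp classical_sets cardinality.

Set Implicit Arguments.
Unset Strict Implicit.
Unset Printing Implicit Defensive.

(* Group expressions in the generators [X]; the group < X | R > is the quotient
   of [gexpr X] by the least congruence containing the group axioms and [R]. *)
Inductive gexpr (X : Type) : Type :=
| GOne : gexpr X
| GGen : X -> gexpr X
| GInv : gexpr X -> gexpr X
| GMul : gexpr X -> gexpr X -> gexpr X.
Arguments GOne {X}.

Declare Scope gexpr_scope.
Delimit Scope gexpr_scope with gx.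
Bind Scope gexpr_scope with gexpr.
Notation "1" := GOne : gexpr_scope.
Notation "x ^-1" := (GInv x) : gexpr_scope.
Notation "x * y" := (GMul x y) : gexpr_scope.

(* [x, y] = x y x^-1 y^-1, unlike MathComp's [~ x, y] = x^-1 y^-1 x y. *)
Definition gcomm (X : Type) (x y : gexpr X) : gexpr X :=
  (x * y * x^-1 * y^-1)%gx.
Notation "[ x , y ]" := (gcomm x y) : gexpr_scope.

Inductive pres_eq (X : Type) (R : gexpr X -> gexpr X -> Prop) :
    gexpr X -> gexpr X -> Prop :=
| pres_rel x y : R x y -> pres_eq R x y
| pres_refl x : pres_eq R x x
| pres_sym x y : pres_eq R x y -> pres_eq R y x
| pres_trans x y z : pres_eq R x y -> pres_eq R y z -> pres_eq R x z
| pres_inv x y : pres_eq R x y -> pres_eq R (x^-1) (y^-1)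
| pres_mul x y u v : pres_eq R x y -> pres_eq R u v -> pres_eq R (x * u) (y * v)
| pres_mulA x y z : pres_eq R (x * (y * z)) (x * y * z)
| pres_mul1 x : pres_eq R (1 * x) x
| pres_mulV x : pres_eq R (x^-1 * x) 1.

HB.instance Definition _ (X : Type) := gen_eqMixin (gexpr X).
HB.instance Definition _ (X : Type) := gen_choiceMixin (gexpr X).

Section Presented.
Variables (X : Type) (R : gexpr X -> gexpr X -> Prop).
Local Open Scope quotient_scope.
Local Notation repr := generic_quotient.repr.

Definition pres_eqb : rel (gexpr X) := fun x y => `[< pres_eq R x y >].

Lemma pres_eqb_refl : reflexive pres_eqb.
Proof. by move=> x; apply/asboolP/pres_refl. Qed.

Lemma pres_eqb_sym : symmetric pres_eqb.
Proof. by move=> x y; apply/asboolP/asboolP; apply: pres_sym. Qed.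

Lemma pres_eqb_trans : transitive pres_eqb.
Proof.
by move=> y x z /asboolP xy /asboolP yz; apply/asboolP/(pres_trans xy yz).
Qed.

Canonical pres_equiv :=
  EquivRel pres_eqb pres_eqb_refl pres_eqb_sym pres_eqb_trans.

Definition presented := {eq_quot pres_equiv}.
HB.instance Definition _ := Choice.on presented.
HB.instance Definition _ := Quotient.on presented.

Lemma presentedP (x y : gexpr X) :
  (\pi_presented x = \pi_presented y) <-> pres_eq R x y.
Proof.
split=> [xy|xy]; last by apply/eqmodP/asboolP.
by have /eqmodP/asboolP := xy.
Qed.

Lemma pres_repr (x : gexpr X) : pres_eq R (repr (\pi_presented x)) x.
Proof. by apply/presentedP; rewrite reprK. Qed.

Definition presented_one : presented := \pi_presented 1%gx.
Definition presented_inv (x : presented) : presented :=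
  \pi_presented ((repr x)^-1)%gx.
Definition presented_mul (x y : presented) : presented :=
  \pi_presented (repr x * repr y)%gx.

Lemma pi_inv (x : gexpr X) :
  presented_inv (\pi_presented x) = \pi_presented (x^-1)%gx.
Proof. exact/presentedP/pres_inv/pres_repr. Qed.

Lemma pi_mul (x y : gexpr X) :
  presented_mul (\pi_presented x) (\pi_presented y) = \pi_presented (x * y)%gx.
Proof. by apply/presentedP/pres_mul; apply: pres_repr. Qed.

Lemma presented_mulA : associative presented_mul.
Proof.
elim/quotW=> x; elim/quotW=> y; elim/quotW=> z.
rewrite (pi_mul y z) (pi_mul x y) (pi_mul x (y * z)%gx) (pi_mul (x * y)%gx z).
exact/presentedP/pres_mulA.
Qed.

Lemma presented_mul1g : left_id presented_one presented_mul.
Proof. by elim/quotW=> x; rewrite pi_mul; apply/presentedP/pres_mul1. Qed.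

Lemma presented_mulVg : left_inverse presented_one presented_inv presented_mul.
Proof.
by elim/quotW=> x; rewrite pi_inv pi_mul; apply/presentedP/pres_mulV.
Qed.

Lemma presented_mulgV : right_inverse presented_one presented_inv presented_mul.
Proof.
move=> x; rewrite -[LHS]presented_mul1g.
rewrite -{1}(presented_mulVg (presented_inv x)) -presented_mulA.
by rewrite [X in presented_mul _ X]presented_mulA presented_mulVg
  presented_mul1g presented_mulVg.
Qed.

Lemma presented_mulg1 : right_id presented_one presented_mul.
Proof.
move=> x; rewrite -(presented_mulVg x) presented_mulA presented_mulgV.
exact: presented_mul1g.
Qed.

HB.instance Definition _ := isGroup.Build presented
  presented_mulA presented_mul1g presented_mulg1
  presented_mulVg presented_mulgV.

Definition presented_gen (x : X) : presented := \pi_presented (GGen x).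

End Presented.

(* The index j in {1, ..., b} is encoded as an element of 'I_b, shifted by 1. *)
Inductive braid_gen (b : nat) : Type :=
| gen_rho1 of 'I_b | gen_tau1 of 'I_b
| gen_rho2 of 'I_b | gen_tau2 of 'I_b
| gen_A12.
Arguments gen_A12 {b}.

Section PureBraid.
Variable b : nat.
Local Open Scope gexpr_scope.
Local Notation E := (gexpr (braid_gen b)).
Local Notation rho1 j := (GGen (gen_rho1 j)).
Local Notation tau1 j := (GGen (gen_tau1 j)).
Local Notation rho2 j := (GGen (gen_rho2 j)).
Local Notation tau2 j := (GGen (gen_tau2 j)).
Local Notation A := (GGen (@gen_A12 b)).
(* F 1 * F 2 * ... * F b and F b * ... * F 2 * F 1, respectively *)
Definition prod_up (F : 'I_b -> E) : E := \big[@GMul _/GOne]_(j < b) F j.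
Definition prod_down (F : 'I_b -> E) : E :=
  \big[@GMul _/GOne]_(j < b) F (rev_ord j).

Inductive braid_rel : E -> E -> Prop :=
| surface1 : braid_rel
    (prod_down (fun j => [(rho1 j)^-1, (tau1 j)^-1] * (tau1 j)^-1)
     * prod_up (fun j => tau1 j)) A
| surface2 : braid_rel
    (prod_up (fun j => [(rho2 j)^-1, tau2 j] * tau2 j)
     * prod_down (fun j => (tau2 j)^-1)) (A^-1)
| rho1_rho2_lt (j k : 'I_b) of j < k : braid_rel [rho1 j, rho2 k] 1
| rho1_rho2_eq (j : 'I_b) : braid_rel [rho1 j, rho2 j] 1
| rho1_rho2_gt (j k : 'I_b) of k < j : braid_rel [rho1 j, rho2 k]
    (A^-1 * rho2 k * (rho2 j)^-1 * A * rho2 j * (rho2 k)^-1)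
| rho1_tau2_lt (j k : 'I_b) of j < k : braid_rel [rho1 j, tau2 k] 1
| rho1_tau2_eq (j : 'I_b) : braid_rel [rho1 j, tau2 j] (A^-1)
| rho1_tau2_gt (j k : 'I_b) of k < j :
    braid_rel [rho1 j, tau2 k] [A^-1, tau2 k]
| rho1_A (j : 'I_b) : braid_rel [rho1 j, A] [(rho2 j)^-1, A]
| tau1_rho2_lt (j k : 'I_b) of j < k : braid_rel [tau1 j, rho2 k] 1
| tau1_rho2_eq (j : 'I_b) :
    braid_rel [tau1 j, rho2 j] ((tau2 j)^-1 * A * tau2 j)
| tau1_rho2_gt (j k : 'I_b) of k < j :
    braid_rel [tau1 j, rho2 k] [(tau2 j)^-1, A]
| tau1_tau2_lt (j k : 'I_b) of j < k : braid_rel [tau1 j, tau2 k] 1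
| tau1_tau2_eq (j : 'I_b) : braid_rel [tau1 j, tau2 j] [(tau2 j)^-1, A]
| tau1_tau2_gt (j k : 'I_b) of k < j : braid_rel [tau1 j, tau2 k]
    ((tau2 j)^-1 * A * tau2 j * A^-1 * tau2 k
     * A * (tau2 j)^-1 * A^-1 * tau2 j * (tau2 k)^-1)
| tau1_A (j : 'I_b) : braid_rel [tau1 j, A] [(tau2 j)^-1, A].

Definition P2 := presented braid_rel.
HB.instance Definition _ := Group.on P2.

Definition A12 : P2 := presented_gen braid_rel gen_A12.

End PureBraid.
Arguments A12 {b}.

Section Admissible.
Variables (b : nat) (gT : finGroupType) (G : {group gT}).
Local Open Scope classical_set_scope.
Local Open Scope group_scope.

Definition admissible_epi (phi : P2 b -> gT) : Prop :=
  [/\ {morph phi : x y / x * y}, range phi = [set` G] & phi A12 <> 1].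

(* The elements of [Aut G] are the permutations of [gT] that restrict to an
   automorphism of G and fix every point outside G. *)
Definition Aut_orbit (phi : P2 b -> gT) : set (P2 b -> gT) :=
  [set (a : {perm gT}) \o phi | a in [set` Aut G]].

Definition Aut_orbits : set (set (P2 b -> gT)) :=
  [set Aut_orbit phi | phi in admissible_epi].

End Admissible.
Arguments Aut_orbits b {gT} G.

Local Open Scope group_scope.

(* MathComp's [extraspecial] is the usual notion: a p-group whose centre is
   cyclic of order p with non-trivial elementary abelian quotient. *)
Lemma extraspecialE (gT : finGroupType) (G : {group gT}) :
  extraspecial G <->
  exists p : nat, [/\ prime p, p.-group G, cyclic 'Z(G), #|'Z(G)| = p
    & (G / 'Z(G) != 1) && p.-abelem (G / 'Z(G))].
Proof.
split=> [[[PhiZ derZ] prZ] | [p [p_pr pG _ oZ /andP[ntGZ abGZ]]]].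
  have nilG : nilpotent G.
    rewrite -quotient_center_nil abelian_nil // sub_der1_abelian //.
    by rewrite derZ.
  have pG : #|'Z(G)|.-group G.
    have /dprodP[_ defG _ _] := nilpotent_pcoreC #|'Z(G)| nilG.
    have K1 : 'O_(#|'Z(G)|%N)^'(G) = 1.
      apply: (TI_center_nil nilG (pcore_normal _ _)).
      rewrite finset.setIC coprime_TIg // (pnat_coprime _ (pcore_pgroup _ _)) //.
      exact: pnat_id.
    have eG : 'O_(#|'Z(G)|%N)(G) = G :> {set gT}.
      by rewrite -[RHS]defG K1 mulg1.
    by move: (pcore_pgroup #|'Z(G)| G); rewrite /pgroup eG.
  exists #|'Z(G)|; split=> //; first exact: prime_cyclic.
  apply/andP; split; last by move: (Phi_quotient_abelem pG); rewrite PhiZ.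
  apply/eqP=> /trivgP; rewrite quotient_sub1 ?gFnorm //.
  rewrite finset.subsetI => /andP[_ cGG].
  by move: prZ; rewrite -derZ (derG1P cGG) cards1.
have prZ : prime #|'Z(G)| by rewrite oZ.
have sPhiZ : 'Phi(G) \subset 'Z(G).
  by apply: Phi_min pG _ abGZ; rewrite gFnorm.
have sderPhi : G^`(1) \subset 'Phi(G).
  by rewrite (Phi_joing pG) joing_subl.
have ntder : G^`(1) != 1.
  apply: contra ntGZ => /eqP/derG1P cGG; rewrite -subG1 quotient_sub1 ?gFnorm //.
  by rewrite finset.subsetI subxx.
have eZ (H : {group gT}) : H :!=: 1 -> H \subset 'Z(G) -> H :=: 'Z(G).
  move=> ntH sHZ; apply/eqP; rewrite finset.eqEsubset sHZ /=.
  by rewrite (prime_meetG prZ) // finset.setIC (finset.setIidPl sHZ).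
split=> //; split; last by apply: (eZ (G^`(1))%G) => //; exact: fintype.subset_trans sPhiZ.
apply: (eZ 'Phi(G)%G) => //.
by apply: contra ntder => /eqP Phi1; rewrite -subG1 -Phi1.
Qed.

(* The relations [r_j, r_k] = 1 and [t_j, t_k] = 1 are listed for j < k only. *)
Definition is_H5 (gT : finGroupType) (G : {group gT}) : Prop :=
  G \isog Grp (r1 : t1 : r2 : t2 : z :
    r1 ^+ 2, t1 ^+ 2, r2 ^+ 2, t2 ^+ 2, z ^+ 2,
    r1 * z * r1^-1 * z^-1, t1 * z * t1^-1 * z^-1,
    r2 * z * r2^-1 * z^-1, t2 * z * t2^-1 * z^-1,
    r1 * r2 * r1^-1 * r2^-1, t1 * t2 * t1^-1 * t2^-1,
    r1 * t1 * r1^-1 * t1^-1 = z^-1, r2 * t2 * r2^-1 * t2^-1 = z^-1,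
    r1 * t2 * r1^-1 * t2^-1, r2 * t1 * r2^-1 * t1^-1).

Definition is_G5 (gT : finGroupType) (G : {group gT}) : Prop :=
  G \isog Grp (r1 : t1 : r2 : t2 : z :
    r1 ^+ 2, t1 ^+ 2, z ^+ 2, r2 ^+ 2 = z, t2 ^+ 2 = z,
    r1 * z * r1^-1 * z^-1, t1 * z * t1^-1 * z^-1,
    r2 * z * r2^-1 * z^-1, t2 * z * t2^-1 * z^-1,
    r1 * r2 * r1^-1 * r2^-1, t1 * t2 * t1^-1 * t2^-1,
    r1 * t1 * r1^-1 * t1^-1 = z^-1, r2 * t2 * r2^-1 * t2^-1 = z^-1,
    r1 * t2 * r1^-1 * t2^-1, r2 * t1 * r2^-1 * t1^-1).

(* Main.v *)
Require Import Defs.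
From mathcomp Require Import all_boot all_fingroup all_solvable.
From mathcomp Require Import boolp classical_sets cardinality.
From mathcomp Require Import zify.

(** Let [A] be the image of [A12] under an admissible epimorphism onto [G].

    Suppose first that [A] is central. The braid relations then say that the
    2b generators of one strand and the 2b generators of the other are dual
    families: each generator commutes with all those of the other strand but
    one, and with that one its commutator is [A] or its inverse. The exponents
    in a product of generators of one strand, each with exponent 0 or 1, can be
    read off from the elements of the other strand that the product commutes
    with ([word_inj]), so that [G] has at least 2 ^ (2b + 1) >= 32 elements.

    A group of least order admitting an admissible epimorphism has [A] in all
    its non-trivial normal subgroups, as otherwise a quotient would do; in
    particular [A] is central if the centre is non-trivial. If the centre is
    trivial, some non-central element has a non-abelian centraliser
    ([adm_nontransitive]), which below order 32 leaves only the order 24, with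
    a centraliser of order 8 or 12. Order 12 gives two normal subgroups that
    meet trivially, the centre and the Sylow 2-subgroup of the centraliser. For
    order 8, [A] lies in a normal subgroup of order 4 with non-abelian quotient
    of order 6. The strands commute modulo that subgroup, so one of them is
    trivial modulo it and commutes with [A]; this makes [A] central, a
    contradiction.

    If [G] has 32 elements, [A] is central, by the bound applied to the quotient
    by the centre. So either strand generates [G] together with [A], and as the
    strands commute modulo [A], the group [G] is extra-special.

    Conversely, let [G] be extra-special of order 32 with centre generated by
    [z]. Commuting defines a symplectic form [om] on [G] modulo its centre, with
    values in the field with two elements. An admissible epimorphism in genus 2
    amounts to a family [p] of four elements, with the dual family [q], such
    that the Gram matrix of each has distinct entries at the two pairs of
    indices (rho_j, tau_j) ([adm_pairs], [adm_epi_image]). The Gram matrix of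
    [q] is the inverse of that of [p], with these two entries exchanged; and [q]
    exists exactly when the pfaffian of the Gram matrix of [p] is 1, and is then
    unique up to signs. Hence there are 16 epimorphisms for each of the
    16 * 12 * 720 families [p] ([card_adm_pairs], [card_adm_first]).

    Automorphisms act freely on these epimorphisms. Fixing a symplectic basis,
    they correspond to the symplectic bases whose elements have the same squares
    ([card_Aut]), since the squares and the form determine the multiplication
    table ([word_mul]). There are 16 * 72 of these for the first group and
    16 * 120 for the second, 72 and 120 being the orders of the orthogonal
    groups of the two quadratic forms. Dividing gives the numbers of orbits. *)

Set Implicit Arguments.
Unset Strict Implicit.
Unset Printing Implicit Defensive.

Local Open Scope card_scope.
Local Open Scope group_scope.

(** * Homomorphisms out of a presented group *)

Section Evaluation.
Variables (X : Type) (R : gexpr X -> gexpr X -> Prop) (gT : groupType).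
Implicit Types (f : X -> gT) (e : gexpr X).

Fixpoint eval f e : gT :=
  match e with
  | GOne => 1
  | GGen x => f x
  | GInv e1 => (eval f e1)^-1
  | GMul e1 e2 => eval f e1 * eval f e2
  end.

Lemma eval_pres_eq f :
  (forall x y, R x y -> eval f x = eval f y) ->
  forall x y, pres_eq R x y -> eval f x = eval f y.
Proof.
move=> fR x y; elim=> //= {x y}.
- by move=> x y z _ -> _ ->.
- by move=> x y _ ->.
- by move=> x y u v _ -> _ ->.
- by move=> x y z; rewrite mulgA.
- by move=> x; rewrite mul1g.
- by move=> x; rewrite mulVg.
Qed.

(** Defined for every assignment of the generators, but multiplicative only
    when the assignment satisfies the relations. *)
Definition pres_lift f (w : presented R) : gT :=
  eval f (generic_quotient.repr w).

Lemma pres_lift_pi f :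
  (forall x y, R x y -> eval f x = eval f y) ->
  forall e, pres_lift f (\pi_(presented R) e)%qT = eval f e.
Proof. by move=> fR e; apply: (eval_pres_eq fR); apply: pres_repr. Qed.

Lemma pres_lift_morph f :
  (forall x y, R x y -> eval f x = eval f y) ->
  {morph pres_lift f : x y / x * y}.
Proof.
by move=> fR x y; rewrite {1}/pres_lift (eval_pres_eq fR (pres_repr _ _)).
Qed.

Variable phi : presented R -> gT.
Hypothesis phiM : {morph phi : x y / x * y}.

Lemma morph_eval e :
  phi (\pi_(presented R) e)%qT = eval (phi \o presented_gen R) e.
Proof.
have phi1 : phi 1 = 1 by apply: (mulgI (phi 1)); rewrite -phiM !mulg1.
have phiV x : phi x^-1 = (phi x)^-1.
  by apply: (mulIg (phi x)); rewrite -phiM !mulVg.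
elim: e => [|x|e IHe|e1 IH1 e2 IH2] //=; first by rewrite -IHe -phiV -pi_inv.
by rewrite -IH1 -IH2 -phiM -pi_mul.
Qed.

Lemma morph_rel x y : R x y ->
  eval (phi \o presented_gen R) x = eval (phi \o presented_gen R) y.
Proof.
by move=> Rxy; rewrite -!morph_eval; congr phi; apply/presentedP/pres_rel.
Qed.

Lemma morph_pres_lift : phi = pres_lift (phi \o presented_gen R).
Proof.
by apply: funext => w; rewrite /pres_lift -morph_eval generic_quotient.reprK.
Qed.

End Evaluation.
Arguments pres_lift {X} R {gT} f w.

Lemma eval_closed (X : Type) (gT : finGroupType) (G : {group gT}) f
    (e : gexpr X) :
  (forall x, f x \in G) -> eval f e \in G.
Proof.
move=> fG; elim: e => [|x|e IHe|e1 IH1 e2 IH2] /=;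
by rewrite ?group1 ?fG ?groupV ?groupM.
Qed.

(** * Assignments satisfying the braid relations *)

Notation gcg x y := (x * y * x^-1 * y^-1).

Lemma gcg_eq1 (gT : groupType) (x y : gT) : gcg x y = 1 <-> commute x y.
Proof.
split=> [h|->]; last by rewrite -[_ * x^-1]mulgA mulgV mulg1 mulgV.
by apply: (mulIg x^-1); apply: (mulIg y^-1); rewrite h mulgK mulgV.
Qed.

Lemma gcg_neq1 (gT : groupType) (x y : gT) : gcg x y <> 1 -> ~ commute x y.
Proof. by move=> n /gcg_eq1. Qed.

Lemma commute_conj (gT : groupType) (x y : gT) :
  commute x y -> x^-1 * y * x = y.
Proof. by move=> c; rewrite -mulgA -c mulKg. Qed.

Section BraidRelations.
Variables (b : nat) (gT : groupType) (f : braid_gen b -> gT).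
Hypothesis fR : forall x y, braid_rel x y -> eval f x = eval f y.
Local Notation r1 j := (f (gen_rho1 j)).
Local Notation t1 j := (f (gen_tau1 j)).
Local Notation r2 j := (f (gen_rho2 j)).
Local Notation t2 j := (f (gen_tau2 j)).
Local Notation A := (f gen_A12).

Lemma braid_lt (j k : 'I_b) : (j < k)%N ->
  [/\ commute (r1 j) (r2 k), commute (r1 j) (t2 k),
      commute (t1 j) (r2 k) & commute (t1 j) (t2 k)].
Proof.
by move=> ljk; split; apply/gcg_eq1; [have := fR (rho1_rho2_lt ljk)
  | have := fR (rho1_tau2_lt ljk) | have := fR (tau1_rho2_lt ljk)
  | have := fR (tau1_tau2_lt ljk)].
Qed.

Lemma braid_rho_eq j : commute (r1 j) (r2 j).
Proof. by apply/gcg_eq1; have := fR (rho1_rho2_eq j). Qed.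

Lemma braid_rho_tau j : gcg (r1 j) (t2 j) = A^-1.
Proof. exact: (fR (rho1_tau2_eq j)). Qed.

Lemma braid_tau_rho j : gcg (t1 j) (r2 j) = (t2 j)^-1 * A * t2 j.
Proof. exact: (fR (tau1_rho2_eq j)). Qed.

Lemma braid_rho_A j : commute (r1 j) A <-> commute (r2 j) A.
Proof.
rewrite -!gcg_eq1 [X in X = 1 <-> _](fR (rho1_A j)) /= !gcg_eq1.
by split=> [/commute_sym/commuteV|/commute_sym/commuteV] c;
  apply: commute_sym; rewrite ?invgK // in c *.
Qed.

Lemma braid_tau_A j : commute (t1 j) A <-> commute (t2 j) A.
Proof.
rewrite -!gcg_eq1 [X in X = 1 <-> _](fR (tau1_A j)) /= !gcg_eq1.
by split=> [/commute_sym/commuteV|/commute_sym/commuteV] c;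
  apply: commute_sym; rewrite ?invgK // in c *.
Qed.

Section CentralA.
Hypotheses (r2A : forall j, commute (r2 j) A) (t2A : forall j, commute (t2 j) A).

Lemma central_rho_rho (j k : 'I_b) : commute (r1 j) (r2 k).
Proof.
have [ljk|lkj|/ord_inj <-] := ltngtP j k; first by case: (braid_lt ljk).
- apply/gcg_eq1; have := fR (rho1_rho2_gt lkj) => /= ->.
  have -> : A^-1 * r2 k * (r2 j)^-1 * A * r2 j * (r2 k)^-1
            = gcg A^-1 (r2 k * (r2 j)^-1) by rewrite invgK invMg invgK !mulgA.
  apply/gcg_eq1/commute_sym/commuteV/commute_sym/commuteM.
    exact: commute_sym.
  exact/commuteV/commute_sym.
- exact: braid_rho_eq.
Qed.

Lemma central_rho_tau (j k : 'I_b) : j != k -> commute (r1 j) (t2 k).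
Proof.
have [ljk|lkj|/ord_inj <-] := ltngtP j k; last by rewrite eqxx.
  by case: (braid_lt ljk).
move=> _; apply/gcg_eq1; have := fR (rho1_tau2_gt lkj) => /= ->.
by apply/gcg_eq1/commute_sym/commuteV.
Qed.

Lemma central_tau_rho (j k : 'I_b) : j != k -> commute (t1 j) (r2 k).
Proof.
have [ljk|lkj|/ord_inj <-] := ltngtP j k; last by rewrite eqxx.
  by case: (braid_lt ljk).
move=> _; apply/gcg_eq1; have := fR (tau1_rho2_gt lkj) => /= ->.
by apply/gcg_eq1/commute_sym/commuteV/commute_sym.
Qed.

Lemma central_tau_rho_eq j : gcg (t1 j) (r2 j) = A.
Proof. by rewrite braid_tau_rho commute_conj. Qed.

Lemma central_tau_tau (j k : 'I_b) : commute (t1 j) (t2 k).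
Proof.
have [ljk|lkj|/ord_inj <-] := ltngtP j k; first by case: (braid_lt ljk).
- apply/gcg_eq1; have := fR (tau1_tau2_gt lkj) => /= ->.
  rewrite commute_conj // mulgV mul1g.
  have -> : t2 k * A * (t2 j)^-1 * A^-1 * t2 j * (t2 k)^-1
            = t2 k * gcg A (t2 j)^-1 * (t2 k)^-1 by rewrite invgK !mulgA.
  have /gcg_eq1-> : commute A (t2 j)^-1 by exact/commuteV/commute_sym.
  by rewrite mulg1 mulgV.
- apply/gcg_eq1; have := fR (tau1_tau2_eq j) => /= ->.
  by apply/gcg_eq1/commute_sym/commuteV/commute_sym.
Qed.

End CentralA.
End BraidRelations.

(** * Dual families *)

Section DualFamilies.
Variables (gT : finGroupType) (I : finType).
Implicit Types (x y : I -> gT) (z : gT) (w : {ffun I -> bool} * bool).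

Definition dual x y := forall i j, (x i \in 'C[y j]) = (i != j).

Definition word x z w : gT := (\prod_i x i ^+ w.1 i) * z ^+ w.2.

Lemma dualC x y : dual x y -> dual y x.
Proof. by move=> xy i j; rewrite cent1C xy eq_sym. Qed.

(** Factors in a subgroup can be cancelled from either end of a product without
    affecting its membership. *)
Lemma prod_mem_except (H : {group gT}) (F : I -> gT) (j : I) :
  (forall i, i != j -> F i \in H) -> (\prod_i F i \in H) = (F j \in H).
Proof.
move=> FH.
suff Fs s : uniq s -> (\prod_(i <- s) F i \in H) = ((j \in s) ==> (F j \in H)).
  by rewrite Fs ?index_enum_uniq // mem_index_enum.
elim: s => [_|i s IHs /= /andP[nis us]]; first by rewrite big_nil group1.
rewrite big_cons in_cons; have [eji|neji] := eqVneq j i.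
  rewrite -eji groupMr //= IHs //; first by rewrite eji (negbTE nis).
by rewrite groupMl ?IHs // FH // eq_sym.
Qed.

Lemma word_cent x y z w j :
  dual x y -> z \in 'C[y j] -> (word x z w \in 'C[y j]) = ~~ w.1 j.
Proof.
move=> xy zy; rewrite /word groupMr ?groupX //.
rewrite (@prod_mem_except _ _ j) => [|i neij]; last by rewrite groupX // xy.
by case: (w.1 j); rewrite ?group1 // expg1 xy eqxx.
Qed.

(** Centralising [y j] reads off the exponent of [x j], so that a family with
    a dual generates many elements. *)
Lemma word_inj x y z :
  dual x y -> (forall j, z \in 'C[y j]) -> z != 1 -> injective (word x z).
Proof.
move=> xy zy nz w w' eww.
have e1 : w.1 = w'.1.
  apply/ffunP=> j; apply: negb_inj.
  by rewrite -!(word_cent _ xy (zy j)) eww.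
case: w w' e1 eww => u e [_ e'] /= <- /mulgI.
by case: e e' => [] [] // /eqP; rewrite ?[1 == _]eq_sym (negbTE nz).
Qed.

Lemma card_words : #|{: {ffun I -> bool} * bool}| = (2 ^ #|I|.+1)%N.
Proof. by rewrite card_prod card_ffun card_bool expnSr. Qed.

Lemma word_closed (G : {group gT}) x z w :
  (forall i, x i \in G) -> z \in G -> word x z w \in G.
Proof.
move=> xG zG; rewrite groupM ?groupX ?group_prod // => i _.
by rewrite groupX.
Qed.

Lemma dual_card_ge (G : {group gT}) x y z :
    dual x y -> (forall j, z \in 'C[y j]) -> z != 1 ->
    (forall i, x i \in G) -> z \in G ->
  (2 ^ #|I|.+1 <= #|G|)%N.
Proof.
move=> xy zy nz xG zG.
rewrite -card_words -cardsT -(card_imset _ (word_inj xy zy nz)).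
by apply/subset_leq_card/fintype.subsetP=> _ /imsetP[w _ ->]; apply: word_closed.
Qed.

Lemma word_onto (G : {group gT}) x y z :
    dual x y -> (forall j, z \in 'C[y j]) -> z != 1 ->
    (forall i, x i \in G) -> z \in G -> #|G| = (2 ^ #|I|.+1)%N ->
  forall g, g \in G -> exists w, g = word x z w.
Proof.
move=> xy zy nz xG zG oG g Gg.
pose S := [set word x z w | w in [set: {ffun I -> bool} * bool]]%SET.
suff : g \in S by case/imsetP=> w _ ->; exists w.
suff -> : S = G by [].
apply/eqP; rewrite finset.eqEcard.
rewrite (card_imset _ (word_inj xy zy nz)) cardsT card_words oG leqnn andbT.
by apply/fintype.subsetP=> _ /imsetP[w _ ->]; apply: word_closed.
Qed.

(** In the normal form of such an element all exponents but the last vanish. *)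
Lemma dual_cent (G : {group gT}) x y z :
    dual x y -> (forall j, z \in 'C[y j]) -> z != 1 ->
    (forall i, x i \in G) -> z \in G -> #|G| = (2 ^ #|I|.+1)%N ->
  forall g, g \in G -> (forall j, g \in 'C[y j]) -> g = 1 \/ g = z.
Proof.
move=> xy zy nz xG zG oG g Gg cg.
have [w ew] := word_onto xy zy nz xG zG oG Gg.
have w0 i : w.1 i = false.
  by apply: negbTE; rewrite -(word_cent w xy (zy i)) -ew.
have -> : g = z ^+ w.2.
  by rewrite ew /word big1 ?mul1g // => i _; rewrite w0.
by case: (w.2); [right; rewrite expg1|left].
Qed.

Lemma dual_center (G : {group gT}) x y z :
    dual x y -> z != 1 -> (forall i, x i \in G) -> (forall i, y i \in G) ->
    z \in 'Z(G) -> #|G| = (2 ^ #|I|.+1)%N ->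
  'Z(G) = [set 1; z]%SET.
Proof.
move=> xy nz xG yG /[dup] Zz /centerP[Gz cz] oG.
have zy j : z \in 'C[y j] by apply/cent1P/cz.
apply/setP=> g; rewrite finset.in_set2; apply/idP/idP; last first.
  by case/orP=> /eqP-> //; apply: group1.
case/centerP=> Gg cg.
have cgj j : g \in 'C[y j] by apply/cent1P/cg.
by case: (dual_cent xy zy nz xG Gz oG Gg cgj) => ->; rewrite eqxx ?orbT.
Qed.

End DualFamilies.

(** * Admissible epimorphisms *)

Definition gen_values (b : nat) (gT : groupType) (phi : P2 b -> gT) :=
  phi \o presented_gen (@braid_rel b).

(** The two strands are indexed so that, when [A12] goes to the centre, the
    relations make them dual families: [rho] of one strand is then paired with
    [tau] of the other. *)
Definition strand1 (b : nat) (gT : Type) (f : braid_gen b -> gT)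
    (i : 'I_b * bool) : gT :=
  if i.2 then f (gen_tau1 i.1) else f (gen_rho1 i.1).

Definition strand2 (b : nat) (gT : Type) (f : braid_gen b -> gT)
    (i : 'I_b * bool) : gT :=
  if i.2 then f (gen_rho2 i.1) else f (gen_tau2 i.1).

Section Admissible.
Variables (b : nat) (gT : finGroupType) (G : {group gT}) (phi : P2 b -> gT).
Hypothesis phiA : admissible_epi G phi.
Local Notation f := (gen_values phi).
Local Notation A := (f gen_A12).

Lemma adm_rel x y : braid_rel x y -> eval f x = eval f y.
Proof. by case: phiA => phiM _ _; apply: morph_rel. Qed.

Lemma adm_in g : f g \in G.
Proof.
have [_ rG _] := phiA.
suff: range phi (f g) by rewrite rG.
by exists (presented_gen (@braid_rel b) g).
Qed.

Lemma adm_A : A != 1.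
Proof. by case: phiA => _ _ nA; apply/eqP. Qed.

Lemma adm_sub (H : {group gT}) : (forall g, f g \in H) -> G \subset H.
Proof.
move=> fH; have [phiM rG _] := phiA; apply/fintype.subsetP=> x Gx.
have : [set` G]%classic x by [].
rewrite -rG => -[w _ <-]; rewrite -(generic_quotient.reprK w) morph_eval //.
exact: eval_closed.
Qed.

Lemma adm_strands_sub (H : {group gT}) :
    (forall i, strand1 f i \in H) -> (forall i, strand2 f i \in H) ->
    A \in H -> G \subset H.
Proof.
move=> H1 H2 HA; apply: adm_sub => -[] // j.
- exact: (H1 (j, false)).
- exact: (H1 (j, true)).
- exact: (H2 (j, true)).
- exact: (H2 (j, false)).
Qed.

Lemma adm_strand1_in i : strand1 f i \in G.
Proof. by rewrite /strand1; case: ifP => _; apply: adm_in. Qed.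

Lemma adm_strand2_in i : strand2 f i \in G.
Proof. by rewrite /strand2; case: ifP => _; apply: adm_in. Qed.

(** Conjugation by [rho_1j] or [tau_1j] moves [A12] as the inverse of the
    corresponding generator of the second strand does. *)
Lemma adm_strand_cent_A :
  (forall i, strand1 f i \in 'C[A]) <-> (forall i, strand2 f i \in 'C[A]).
Proof.
have rA j := braid_rho_A adm_rel j; have tA j := braid_tau_A adm_rel j.
split=> h [j [] ]; apply/cent1P; first [apply/rA | apply/tA].
- by apply/cent1P/(h (j, false)).
- by apply/cent1P/(h (j, true)).
- by apply/cent1P/(h (j, false)).
- by apply/cent1P/(h (j, true)).
Qed.

Lemma adm_center_A : (forall i, strand2 f i \in 'C[A]) -> A \in 'Z(G).
Proof.
move=> h2; have h1 := adm_strand_cent_A.2 h2.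
rewrite finset.inE adm_in -sub_cent1.
by apply: adm_strands_sub => //; apply/cent1P.
Qed.

Lemma adm_dual : A \in 'Z(G) -> dual (strand1 f) (strand2 f).
Proof.
case/centerP=> _ cA.
have cr j : commute (f (gen_rho2 j)) A by apply/commute_sym/cA/adm_in.
have ct j : commute (f (gen_tau2 j)) A by apply/commute_sym/cA/adm_in.
have nA := elimN eqP adm_A.
case=> [j s] [k t]; rewrite xpair_eqE /strand1 /strand2 /=.
have [<-|njk] := eqVneq j k; case: s t => -[] /=.
- apply/negbTE/negP=> /cent1P/gcg_eq1.
  by rewrite (central_tau_rho_eq adm_rel).
- exact/cent1P/(central_tau_tau adm_rel).
- exact/cent1P/(central_rho_rho adm_rel).
- apply/negbTE/negP=> /cent1P/gcg_eq1; rewrite (braid_rho_tau adm_rel).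
  by move/eqP; rewrite invg_eq1 => /eqP.
- exact/cent1P/(central_tau_rho adm_rel).
- exact/cent1P/(central_tau_tau adm_rel).
- exact/cent1P/(central_rho_rho adm_rel).
- exact/cent1P/(central_rho_tau adm_rel).
Qed.

Lemma adm_central_card : A \in 'Z(G) -> (2 ^ (b * 2).+1 <= #|G|)%N.
Proof.
move=> ZA.
have -> : (b * 2 = #|{: 'I_b * bool}|)%N by rewrite card_prod card_ord card_bool.
apply: (dual_card_ge (adm_dual ZA) _ adm_A adm_strand1_in (adm_in _)).
by move=> i; case/centerP: ZA => _ cA; apply/cent1P/cA/adm_strand2_in.
Qed.

(** For j < k, [rho_1j] commutes with [rho_2k] and [tau_2k], and [rho_2k]
    commutes with [rho_1k]. Were all centralisers of non-central
    elements abelian, [rho_2k] would commute with [tau_2k], and then [rho_1k]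
    with [tau_2k], although their commutator is the inverse of [A12]. *)
Lemma adm_nontransitive : (1 < b)%N ->
  exists x, [/\ x \in G, x \notin 'Z(G) & ~~ abelian 'C_G[x]].
Proof.
move=> b1; pose j : 'I_b := Ordinal (ltnW b1); pose k := Ordinal b1.
have ljk : (j < k)%N by [].
have [crr crt ctr ctt] := braid_lt adm_rel ljk.
have nAV : A^-1 <> 1 by move/eqP; rewrite invg_eq1 (negbTE adm_A).
have nrt i : ~ commute (f (gen_rho1 i)) (f (gen_tau2 i)).
  by apply: gcg_neq1; rewrite (braid_rho_tau adm_rel).
have nontriv x y z : x \in G -> y \in G -> z \in G -> commute x y ->
    commute x z -> ~ commute y z -> ~~ abelian 'C_G[x].
  move=> Gx Gy Gz cxy cxz; apply: contra_notN => /centsP; apply.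
    by rewrite finset.inE Gy; apply/cent1P/commute_sym.
  by rewrite finset.inE Gz; apply/cent1P/commute_sym.
case: (boolP (f (gen_tau2 k) \in 'C[f (gen_rho2 k)])) => [/cent1P c2|/cent1P n2].
  exists (f (gen_rho2 k)); split; first exact: adm_in.
    apply/negP=> /centerP[_ /(_ _ (adm_in (gen_tau1 k)))/commute_sym].
    apply: gcg_neq1; rewrite (braid_tau_rho adm_rel) -[_ * _ * _]/(_^-1 * _ * _).
    rewrite -mulgA => /(congr1 (conjg^~ (f (gen_tau2 k))^-1)).
    by move/eqP; rewrite mulgA -mulgA -/(conjg _ _) conjgK conj1g (negbTE adm_A).
  apply: (nontriv _ (f (gen_rho1 k)) (f (gen_tau2 k))); rewrite ?adm_in //.
    exact/commute_sym/(braid_rho_eq adm_rel).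
exists (f (gen_rho1 j)); split; first exact: adm_in.
  by apply/negP=> /centerP[_ /(_ _ (adm_in (gen_tau2 j)))]; apply: nrt.
apply: (nontriv _ (f (gen_rho2 k)) (f (gen_tau2 k))); rewrite ?adm_in //.
by move/commute_sym.
Qed.

End Admissible.

Lemma adm_quotient (b : nat) (gT : finGroupType) (G N : {group gT})
    (phi : P2 b -> gT) :
    admissible_epi G phi -> N <| G -> gen_values phi gen_A12 \notin N ->
  admissible_epi (G / N) (coset N \o phi).
Proof.
move=> phiA nNG nA; have [phiM rG _] := phiA; have nN := normal_norm nNG.
have Gphi w : phi w \in G.
  by have : [set` G]%classic (phi w); [rewrite -rG; exists w|].
split.
- by move=> x y /=; rewrite phiM morphM ?(fintype.subsetP nN).
- apply/seteqP; split=> [_ [w _ <-]|y /=]; first exact: mem_quotient.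
  case/morphimP=> x _ Gx ->.
  have : [set` G]%classic x by [].
  by rewrite -rG => -[w _ <-]; exists w.
- move/coset_idr => h; move: nA; rewrite h //.
  exact: (fintype.subsetP nN).
Qed.

(** * Groups of order less than 32 *)

Section SmallGroups.
Variable gT : finGroupType.
Implicit Types (G H N Q : {group gT}).

Lemma normal_card2_center G N : N <| G -> #|N| = 2%N -> N \subset 'Z(G).
Proof.
case/andP=> sNG nNG oN; rewrite finset.subsetI sNG /=.
apply/centsP=> x Nx g Gg; apply/commgP.
have NxJ : x ^ g \in N by rewrite memJ_norm ?(fintype.subsetP nNG).
rewrite -conjg_fix; have [->|nx] := eqVneq x 1; first by rewrite conj1g.
have nxg : x ^ g != 1 by rewrite conjg_eq1.
apply: contraT => ne.
have : #|[set 1; x; x ^ g]%SET| <= #|N|.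
  by apply/subset_leq_card; rewrite !finset.subUset !finset.sub1set group1 Nx.
by rewrite oN -finset.setUA cardsU1 cards2 !finset.inE (eq_sym 1 x)
  (eq_sym 1 (x ^ g)) (eq_sym x (x ^ g)) (negbTE nx) (negbTE nxg) (negbTE ne).
Qed.

Lemma indexg_of_card G H m n : H \subset G ->
  #|H| = m -> #|G| = (m * n)%N -> (0 < m)%N -> #|G : H| = n.
Proof.
move=> sHG oH oG m0; apply/eqP; rewrite -(eqn_pmul2l m0) -oG -oH.
by rewrite Lagrange.
Qed.

Lemma center_index_noncyclic G : ~~ abelian G ->
  (4 <= #|G : 'Z(G)| /\ ~~ prime #|G : 'Z(G)|)%N.
Proof.
move=> nab.
have idx : #|G / 'Z(G)| = #|G : 'Z(G)| by rewrite card_quotient ?gFnorm.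
have nc : ~~ cyclic (G / 'Z(G)).
  by apply: contra nab; apply: cyclic_center_factor_abelian.
have npr : ~~ prime #|G : 'Z(G)|.
  by rewrite -idx; apply: contra nc; apply: prime_cyclic.
have n1 : #|G : 'Z(G)| != 1%N.
  by rewrite -idx -trivg_card1; apply: contra nc => /eqP->; apply: cyclic1.
split=> //; have := indexg_gt0 G 'Z(G).
by case: #|_ : _| npr n1 => [|[|[|[|n]]]].
Qed.

Lemma nonabelian6_center1 Q : #|Q| = 6%N -> ~~ abelian Q -> 'Z(Q) = 1.
Proof.
move=> oQ /center_index_noncyclic[i4 ip].
have := Lagrange (center_sub Q); rewrite oQ => h.
apply/eqP; rewrite trivg_card1; apply/eqP.
move: i4 ip h (cardG_gt0 'Z(Q)); case: #|_ : _| => [|[|[|[|[|[|[|n]]]]]]] //; lia.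
Qed.

(** Proper subgroups of a group of order 6 are cyclic, and commuting abelian
    subgroups generate an abelian group; so one factor is [Q], and the other is
    central, hence trivial. *)
Lemma nonabelian6_factors Q H1 H2 :
    #|Q| = 6%N -> ~~ abelian Q -> H1 \subset Q -> H2 \subset Q ->
    H2 \subset 'C(H1) -> Q \subset H1 <*> H2 ->
  H1 :=: 1 \/ H2 :=: 1.
Proof.
move=> oQ nQ sH1 sH2 cH gQ; have Z1 := nonabelian6_center1 oQ nQ.
have ab H : H \subset Q -> abelian H \/ H :=: Q.
  move=> sHQ; have := Lagrange sHQ; rewrite oQ => h.
  have [->|nHQ] := eqVneq (H : {set gT}) Q; [by right | left].
  have H6 : #|H| != 6%N.
    by apply: contra nHQ => /eqP o6; rewrite finset.eqEcard sHQ oQ o6.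
  have : (#|H| == 1%N) || prime #|H|.
    have : (#|H| %| 6)%N by rewrite -oQ cardSg.
    move: H6; case: #|H| => [|[|[|[|[|[|[|n]]]]]]] // _ /dvdn_leq; lia.
  case/orP; last by move/prime_cyclic/cyclic_abelian.
  by rewrite -trivg_card1 => /eqP->; apply: abelian1.
have [ab1|e1] := ab _ sH1; last first.
  by right; apply/trivgP; rewrite -Z1 finset.subsetI sH2 -e1.
have [ab2|e2] := ab _ sH2; last first.
  by left; apply/trivgP; rewrite -Z1 finset.subsetI sH1 -e2 centsC.
case/negP: nQ; apply: abelianS gQ _.
by rewrite abelianY ab1 ab2.
Qed.

(** The centraliser is a proper subgroup that is non-abelian with non-trivial
    centre. Such a group has 8 or 12 elements if it has at most 15, so that [G]
    has 16 or 24; and a group of order 16 has a non-trivial centre. *)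
Lemma centralizer_orders G x :
    (#|G| < 32)%N -> 'Z(G) = 1 -> x \in G -> x != 1 -> ~~ abelian 'C_G[x] ->
  #|G| = 24%N /\ (#|'C_G[x]| = 12%N \/
    #|'C_G[x]| = 8%N /\ #|'Z('C_G[x])| = 2%N).
Proof.
move=> G32 Z1 Gx nx nab; have [i4 ip] := center_index_noncyclic nab.
have sC : 'C_G[x] \subset G by apply: finset.subsetIl.
have xZ : x \in 'Z('C_G[x]).
  apply/centerP; rewrite finset.inE Gx cent1id; split=> // y.
  by case/finset.setIP=> _ /cent1P.
have Z2 : (2 <= #|'Z('C_G[x])|)%N.
  rewrite ltnNge -trivg_card_le1; apply: contra nx => /eqP h.
  by rewrite h finset.inE in xZ.
have k2 : (2 <= #|G : 'C_G[x]|)%N.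
  rewrite ltnNge; apply: contra nx => k1.
  have k1' : #|G : 'C_G[x]| == 1%N by rewrite eqn_leq k1 indexg_gt0.
  rewrite indexg_eq1 in k1'.
  suff : x \in 'Z(G) by rewrite Z1 finset.inE.
  apply/centerP; split=> // y Gy.
  by have := fintype.subsetP k1' y Gy => /finset.setIP[_ /cent1P].
have n16 : #|G| != 16%N.
  apply/eqP=> o16; have pG : 2.-group G by rewrite /pgroup o16.
  by have := trivg_center_pgroup pG Z1 => G1; rewrite G1 cards1 in o16.
have := Lagrange sC; have := Lagrange (center_sub 'C_G[x]).
move: i4 ip Z2 k2 n16 G32.
move: (#|'C_G[x] : _|) (#|G : _|) (#|'Z(_)|) (#|'C_G[x]|) (#|G|).
move=> m k c n g m4 mp c2 k2 g16 g32 en eg.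
have n15 : (n <= 15)%N by nia.
have m7 : (m <= 7)%N by nia.
have [m5 m7'] : m != 5%N /\ m != 7%N by split; apply: contra mp => /eqP->.
have {m5 m7' m4 m7 mp} [em|em] : m = 4%N \/ m = 6%N by lia.
  have [ec|ec] : c = 2%N \/ c = 3%N by nia.
      by subst; have -> : k = 3%N; [lia | split=> //; right].
  by subst; have -> : k = 2%N; [lia | split=> //; left].
have ec : c = 2%N by nia.
by subst; have -> : k = 2%N; [lia | split=> //; left].
Qed.

End SmallGroups.

(** * The bound on the order *)

Section NoSmallGroup.
Variables (b : nat) (gT : finGroupType) (G : {group gT}) (phi : P2 b -> gT).
Hypothesis phiA : admissible_epi G phi.
Local Notation f := (gen_values phi).
Local Notation A := (f gen_A12).

(** Once [A12] is trivial, every relation between the two strands says that two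
    generators commute. *)
Lemma adm_quotient_commute (N : {group gT}) i j : N <| G -> A \in N ->
  commute (coset N (strand1 f i)) (coset N (strand2 f j)).
Proof.
move=> nNG NA; have [phiM _ _] := phiA.
have Gphi w : phi w \in G by rewrite (morph_pres_lift phiM); apply/eval_closed/adm_in.
have qM : {morph coset N \o phi : x y / x * y}.
  by move=> x y /=; rewrite phiM morphM ?(fintype.subsetP (normal_norm nNG)).
have fR := morph_rel qM.
set h := (X in eval X) in fR.
have hA : h gen_A12 = 1 by rewrite /h /= coset_id.
have cA x : commute x (h gen_A12) by rewrite hA; apply: commute1.
have [r2A t2A] : (forall k, commute (h (gen_rho2 k)) (h gen_A12)) /\
  (forall k, commute (h (gen_tau2 k)) (h gen_A12)) by [].
case: i j => [j s] [k t]; rewrite /strand1 /strand2.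
have [<-|njk] := eqVneq j k; case: s t => -[] /=.
- by apply/gcg_eq1; rewrite -hA; apply: (central_tau_rho_eq fR).
- exact: (central_tau_tau fR).
- exact: (central_rho_rho fR).
- by apply/gcg_eq1; rewrite -[RHS]invg1 -hA; apply: (braid_rho_tau fR).
- exact: (central_tau_rho fR).
- exact: (central_tau_tau fR).
- exact: (central_rho_rho fR).
- exact: (central_rho_tau fR).
Qed.

(** The quotient is generated by the images of the two strands, which commute,
    so that one strand lies in [D] and commutes with [A12]. By
    [adm_strand_cent_A] the other does too. *)
Lemma adm_index6 (D : {group gT}) :
    D <| G -> abelian D -> A \in D -> #|G / D| = 6%N -> ~~ abelian (G / D) ->
  A \in 'Z(G).
Proof.
move=> nDG aD DA o6 nab.
pose S (s : 'I_b * bool -> gT) := <<[set coset D (s i) | i : 'I_b * bool]%SET>>%G.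
have sS s : (forall i, s i \in G) -> S s \subset G / D.
  move=> sG; rewrite gen_subG; apply/fintype.subsetP=> _ /imsetP[i _ ->].
  exact: mem_quotient.
have S1 s : (forall i, s i \in G) -> S s :=: 1 -> forall i, s i \in D.
  move=> sG s1 i; apply: coset_idr; first exact: (fintype.subsetP (normal_norm nDG)).
  by apply/set1P; rewrite -[[set 1]%SET]s1 mem_gen //; apply/imsetP; exists i.
have cS : S (strand2 f) \subset 'C(S (strand1 f)).
  rewrite cent_gen gen_subG; apply/centsP=> _ /imsetP[j _ ->] _ /imsetP[i _ ->].
  by apply/commute_sym/adm_quotient_commute.
have gS : G / D \subset S (strand1 f) <*> S (strand2 f).
  rewrite quotientE sub_morphim_pre ?normal_norm //.
  have nD g : g \in G -> g \in 'N(D) by apply/fintype.subsetP/normal_norm.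
  apply: (adm_strands_sub phiA) => [i|i|]; apply/morphpreP.
  - rewrite nD ?adm_strand1_in //; split=> //; apply: mem_gen.
    by rewrite finset.inE mem_gen //; apply/imsetP; exists i.
  - rewrite nD ?adm_strand2_in //; split=> //; apply: mem_gen.
    rewrite finset.inE [X in _ || X]mem_gen ?orbT //.
    by apply/imsetP; exists i.
  - by rewrite nD ?adm_in //= coset_id ?group1.
have DC x : x \in D -> x \in 'C[A].
  by move=> Dx; apply/cent1P; apply: (centsP aD).
apply: adm_center_A => //.
have [/S1 s1|/S1 s2] := nonabelian6_factors o6 nab
  (sS _ (adm_strand1_in phiA)) (sS _ (adm_strand2_in phiA)) cS gS.
  by apply/(adm_strand_cent_A phiA) => i; apply/DC/s1/adm_strand1_in.
by move=> i; apply/DC/s2/adm_strand2_in.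
Qed.

Hypotheses (b2 : (1 < b)%N) (Z1 : 'Z(G) = 1).
Hypothesis monolithic :
  forall N : {group gT}, N <| G -> N :!=: 1 -> A \in N.

Lemma normal_card_neq2 (N : {group gT}) : N <| G -> #|N| <> 2%N.
Proof.
by move=> nNG oN; have := subset_leq_card (normal_card2_center nNG oN);
  rewrite Z1 cards1 oN.
Qed.

(** The centre of [C] would have order 3, as a normal subgroup of order 2 is
    central. Then [C] would be nilpotent, and its centre and its Sylow
    2-subgroup two non-trivial normal subgroups of [G] meeting trivially. *)
Lemma adm_no_index2 (C : {group gT}) :
  C \subset G -> #|G| = 24%N -> #|C| = 12%N -> 'Z(C) != 1 -> ~~ abelian C ->
  False.
Proof.
move=> sCG oG oC nZ nab.
have nCG : C <| G.
  by apply: index2_normal => //; rewrite (indexg_of_card (n := 2) sCG oC).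
have nZG : 'Z(C) <| G := char_normal_trans (center_char C) nCG.
have [i4 ip] := center_index_noncyclic nab.
have := Lagrange (center_sub C); rewrite oC => h.
have n1 : #|'Z(C)| != 1%N by rewrite -trivg_card1.
have n2 : #|'Z(C)| != 2%N by apply/eqP/normal_card_neq2.
have [oZ oi] : #|'Z(C)| = 3%N /\ #|C : 'Z(C)| = 4%N.
  move: h i4 n1 n2; move: (#|C : _|) (#|'Z(C)|) => i c h i4 n1 n2.
  have c3 : (c <= 3)%N by nia.
  have ec : c = 3%N by case: c h n1 n2 c3 => [|[|[|[|c]]]].
  by subst c; split=> //; lia.
have nilC : nilpotent C.
  rewrite -quotient_center_nil; apply: (@pgroup_nil _ 2).
  by rewrite /pgroup card_quotient ?gFnorm // oi.
have oP : #|'O_2(C)| = 4%N.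
  by rewrite (card_Hall (nilpotent_pcore_Hall 2 nilC)) oC p_part.
have nPG : 'O_2(C) <| G := char_normal_trans (pcore_char 2 C) nCG.
have nP1 : 'O_2(C) != 1 by rewrite trivg_card1 oP.
have : A \in 'O_2(C) :&: 'Z(C).
  by rewrite finset.inE (monolithic nPG) // (monolithic nZG).
rewrite coprime_TIg ?oP ?oZ // => /set1P A1.
by have := adm_A phiA; rewrite A1 eqxx.
Qed.

(** [C] is not normal, as its centre would be too. It meets a conjugate in a
    subgroup [D] of order 4, normalised by both and so normal in [G]; and
    [adm_index6] applies to [D]. *)
Lemma adm_no_index3 (C : {group gT}) :
  C \subset G -> #|G| = 24%N -> #|C| = 8%N -> #|'Z(C)| = 2%N -> False.
Proof.
move=> sCG oG oC oZ.
have nCG : ~~ (G \subset 'N(C)).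
  apply/negP=> nC; have nCG : C <| G by rewrite /normal sCG.
  exact: (normal_card_neq2 (char_normal_trans (center_char C) nCG)).
have [g Gg nCg] := fintype.subsetPn nCG.
pose D := (C :&: C :^ g)%G.
have sCgG : C :^ g \subset G by rewrite -(conjGid Gg) conjSg.
have oCg : #|C :^ g| = 8%N by rewrite cardJg.
have neC : C :^ g != C by apply: contra nCg => /eqP e; apply/normP.
have sDC : D \subset C by apply: finset.subsetIl.
have sDCg : D \subset C :^ g by apply: finset.subsetIr.
have oD : #|D| = 4%N.
  (* the product of [C] and its conjugate has at most 24 elements *)
  have := mul_cardG C (C :^ g)%G; rewrite /= oC oCg.
  have : (#|(C * C :^ g)%g| <= 24)%N.
    by rewrite -oG subset_leq_card // mul_subG.
  have := cardSg sDC; rewrite oC.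
  have : #|D| != 8%N.
    apply: contra neC => /eqP o8.
    have eC : D :=: C by apply/eqP; rewrite finset.eqEcard sDC oC o8.
    by rewrite eq_sym finset.eqEcard oC oCg leqnn andbT -{1}eC.
  rewrite /D /=; move: (#|_ :&: _|) (#|(C * C :^ g)%g|) => d m d8 dd m24 e.
  have : (d <= 8)%N by apply: dvdn_leq.
  clear -dd d8 e m24.
  by move: dd d8 e m24; case: d => [|[|[|[|[|[|[|[|[|d]]]]]]]]] //; lia.
have nD (H : {group gT}) : D \subset H -> #|H| = 8%N -> H \subset 'N(D).
  move=> sDH oH; apply/normal_norm/index2_normal => //.
  by rewrite (indexg_of_card (n := 2) sDH oD).
have nDG : D <| G.
  rewrite /normal (fintype.subset_trans sDC sCG) /=.
  have sC : C \subset 'N_G(D) by rewrite finset.subsetI sCG nD.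
  have sCg : C :^ g \subset 'N_G(D) by rewrite finset.subsetI sCgG (nD (C :^ g)%G).
  have eG : 'N_G(D) :=: G.
    apply/eqP; rewrite finset.eqEcard finset.subsetIl oG.
    have dvd n : n != 8%N -> (n %| 24)%N -> (8 %| n)%N -> (24 <= n)%N.
      clear=> n8 d24 /dvdnP[q eq]; subst n.
      have := dvdn_leq (isT : (0 < 24)%N) d24.
      by case: q d24 n8 => [|[|[|q]]] // _ _; lia.
    apply: dvd; last by rewrite -oC cardSg.
      apply: contra neC => /eqP o8; rewrite finset.eqEcard oCg oC leqnn andbT.
      apply: fintype.subset_trans sCg _.
      suff <- : C :=: 'N_G(D) by [].
      by apply/eqP; rewrite finset.eqEcard sC oC o8.
    by rewrite -oG cardSg // finset.subsetIl.
  by rewrite -{1}eG finset.subsetIr.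
have aD : abelian D by apply: (@card_p2group_abelian _ 2).
have nD1 : D :!=: 1 by rewrite trivg_card1 oD.
have DA := monolithic nDG nD1.
have o6 : #|G / D| = 6%N.
  rewrite card_quotient ?normal_norm //.
  by rewrite (indexg_of_card (n := 6) (normal_sub nDG) oD).
have : A \in 'Z(G).
  apply: (adm_index6 nDG) => //; apply/negP=> abQ.
  move/negP: nCG; apply; apply/normal_norm/(sub_der1_normal _ sCG).
  apply: fintype.subset_trans sDC.
  by rewrite der1_min ?normal_norm.
rewrite Z1 => /set1P A1.
by have := adm_A phiA; rewrite A1 eqxx.
Qed.

Lemma adm_monolithic_card : (32 <= #|G|)%N.
Proof.
rewrite leqNgt; apply/negP=> G32.
have [x [Gx nZx nab]] := adm_nontransitive phiA b2.
have nx : x != 1 by apply: contra nZx => /eqP->; apply: group1.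
have sC : 'C_G[x] \subset G by apply: finset.subsetIl.
have [oG [oC|[oC oZ]]] := centralizer_orders G32 Z1 Gx nx nab.
  apply: (adm_no_index2 sC oG oC _ nab).
  apply: contra nx => /eqP zC; suff : x \in 'Z('C_G[x]) by rewrite zC => /set1P->.
  apply/centerP; rewrite finset.inE Gx cent1id; split=> // y.
  by case/finset.setIP=> _ /cent1P.
exact: (adm_no_index3 sC oG oC oZ).
Qed.

End NoSmallGroup.

(** A group of least order admitting an admissible epimorphism has [A12] in each
    of its non-trivial normal subgroups, and in particular in its centre if this
    is non-trivial. *)
Lemma adm_card_ge32 (b : nat) (gT : finGroupType) (G : {group gT})
    (phi : P2 b -> gT) :
  (2 <= b)%N -> admissible_epi G phi -> (32 <= #|G|)%N.
Proof.
move=> b2; have [n] := ubnP #|G|.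
elim: n gT G phi => // n IHn gT G phi Gn phiA.
have [ZA|nZA] := boolP (gen_values phi gen_A12 \in 'Z(G)).
  apply: leq_trans (adm_central_card phiA ZA).
  by rewrite -[32%N]/(2 ^ 5)%N leq_pexp2l // ltnS (leq_mul b2 (leqnn 2)).
rewrite leqNgt; apply/negP=> G32.
have monolithic (N : {group gT}) :
    N <| G -> N :!=: 1 -> gen_values phi gen_A12 \in N.
  move=> nNG N1; apply: contraLR G32 => nA; rewrite -leqNgt.
  have lq := ltn_quotient N1 (normal_sub nNG).
  apply: leq_trans (ltnW lq).
  apply: (IHn _ (G / N)%G (coset N \o phi)); first exact: leq_trans lq _.
  exact: adm_quotient.
have Z1 : 'Z(G) = 1.
  apply/eqP; apply: contraR nZA => nZ; apply: (monolithic 'Z(G)%G) => //.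
  exact: center_normal.
by have := adm_monolithic_card phiA b2 Z1 monolithic; rewrite leqNgt G32.
Qed.

(** * Groups of order 32 *)

(** Commutators are central of order at most 2, so squares are central. *)
Lemma abelem_center_quotient (gT : finGroupType) (G : {group gT}) :
  #|'Z(G)| = 2%N -> abelian (G / 'Z(G)) -> 2.-abelem (G / 'Z(G)).
Proof.
move=> oZ ab; rewrite abelemE // ab /=; apply/exponentP=> _ /morphimP[g nZg Gg ->].
rewrite -morphX //; apply: coset_id; apply/centerP; rewrite groupX //; split=> // h Gh.
have Zc : [~ g, h] \in 'Z(G).
  have := der1_min (normal_norm (center_normal G)) ab; move/fintype.subsetP; apply.
  exact: mem_commg.
have c2 : [~ g, h] * [~ g, h] = 1.
  apply/eqP; rewrite -{2}[[~ g, h]]expg1 -expgS -order_dvdn -oZ.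
  exact: order_dvdG.
apply/commgP; rewrite expgS expg1 commMgJ conjgE.
by case/centerP: Zc => _ /(_ g Gg) ->; rewrite mulKg c2.
Qed.

Lemma extraspecial_card2 (gT : finGroupType) (G : {group gT}) :
  2.-group G -> #|'Z(G)| = 2%N -> (2 < #|G|)%N -> abelian (G / 'Z(G)) ->
  extraspecial G.
Proof.
move=> pG oZ G2 ab; apply/extraspecialE; exists 2%N; split=> //.
  by rewrite prime_cyclic ?oZ.
rewrite abelem_center_quotient // andbT; apply: contraTneq G2 => Q1.
rewrite -leqNgt -oZ subset_leq_card // -quotient_sub1 ?gFnorm //.
by rewrite Q1.
Qed.

Section Order32.
Variables (b : nat) (gT : finGroupType) (G : {group gT}) (phi : P2 b -> gT).
Hypotheses (phiA : admissible_epi G phi) (b2 : (2 <= b)%N) (oG : #|G| = 32%N).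
Local Notation f := (gen_values phi).
Local Notation A := (f gen_A12).

(** Otherwise [A12] would survive in the quotient by the centre. *)
Lemma adm32_central : A \in 'Z(G).
Proof.
apply: contraT => nA.
have := adm_card_ge32 b2 (adm_quotient phiA (center_normal G) nA).
have pG : 2.-group G by rewrite /pgroup oG.
have nZ : 'Z(G) != 1.
  by apply/eqP=> /(trivg_center_pgroup pG) G1; have := oG; rewrite G1 cards1.
by rewrite leqNgt -{1}oG ltn_quotient ?center_sub.
Qed.

Lemma adm32_rank : #|G| = (2 ^ #|{: 'I_b * bool}|.+1)%N.
Proof.
have := adm_central_card phiA adm32_central.
rewrite card_prod card_ord card_bool oG -[32%N]/(2 ^ 5)%N leq_exp2l //.
by case: b b2 => [|[|[|c]]].
Qed.

(** Each strand, together with [A12], already generates [G], and the strands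
    commute modulo [A12]: so [G] is abelian modulo its centre. *)
Lemma adm32_extraspecial : extraspecial G.
Proof.
have ZA := adm32_central; have d12 := adm_dual phiA ZA.
have oZ : #|'Z(G)| = 2%N.
  rewrite (dual_center d12 (adm_A phiA) (adm_strand1_in phiA)
    (adm_strand2_in phiA) ZA adm32_rank).
  by rewrite cards2 eq_sym (adm_A phiA).
have GA := adm_in phiA gen_A12.
have cA x : x \in G -> A \in 'C[x].
  by case/centerP: ZA => _ h Gx; apply/cent1P/h.
apply: extraspecial_card2 => //; rewrite ?oG //; first by rewrite /pgroup oG.
have nZ x : x \in G -> x \in 'N('Z(G)).
  exact/fintype.subsetP/normal_norm/center_normal.
have c1 j g : g \in G ->
    coset 'Z(G) g \in 'C[coset 'Z(G) (strand2 f j)].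
  move=> Gg; have cA2 i : A \in 'C[strand2 f i] by apply/cA/adm_strand2_in.
  have [w ->] := word_onto d12 cA2 (adm_A phiA) (adm_strand1_in phiA)
    GA adm32_rank Gg.
  suff : word (strand1 f) A w \in
      (coset 'Z(G) @*^-1 'C[coset 'Z(G) (strand2 f j)])%G.
    by case/morphpreP.
  apply: word_closed => [i|]; apply/morphpreP; rewrite nZ ?adm_in ?adm_strand1_in //.
    split=> //; apply/cent1P/(adm_quotient_commute phiA) => //.
    exact: center_normal.
  by split=> //; rewrite /= (coset_id ZA) group1.
apply/centsP=> _ /morphimP[g nZg Gg ->] _ /morphimP[h nZh Gh ->].
have cA1 i : A \in 'C[strand1 f i] by apply/cA/adm_strand1_in.
have [w eh] := word_onto (dualC d12) cA1 (adm_A phiA) (adm_strand2_in phiA)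
  GA adm32_rank Gh.
suff : h \in (coset 'Z(G) @*^-1 'C[coset 'Z(G) g])%G.
  by case/morphpreP=> _ /cent1P/commute_sym.
rewrite eh; apply: word_closed => [i|]; apply/morphpreP;
  rewrite nZ ?adm_in ?adm_strand2_in //.
  by split=> //; have := c1 i g Gg; rewrite cent1C.
by split=> //; rewrite /= (coset_id ZA) group1.
Qed.

End Order32.

(** * The commutator form of an extra-special 2-group *)

(** The commutator of two elements is determined by whether they commute, as
    the only non-trivial commutator is the generator of the centre. *)
Definition om (gT : finGroupType) (x y : gT) : bool := x \notin 'C[y].

Definition sq (gT : finGroupType) (x : gT) : bool := x ^+ 2 != 1.

Notation bsum F := (\big[addb/false]_i F i).

Section CommutatorForm.
Variables (gT : finGroupType) (G : {group gT}) (z : gT).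
Implicit Types (x y w : gT).
Hypotheses (esG : extraspecial G) (Zz : 'Z(G) = [set 1; z]%SET) (nz : z != 1).

Lemma gcg_om x y : x \in G -> y \in G -> gcg x y = z ^+ om x y.
Proof.
move=> Gx Gy; rewrite /om; have [/cent1P/gcg_eq1 //|/cent1P nc] := boolP (x \in _).
have : gcg x y \in 'Z(G).
  case: esG => -[_ <-] _.
  have -> : gcg x y = [~ x^-1, y^-1] by rewrite commgEl conjgE !invgK !mulgA.
  by rewrite mem_commg ?groupV.
by rewrite Zz finset.in_set2 expg1 => /orP[/eqP/gcg_eq1 //|/eqP].
Qed.

Lemma zZ : z \in 'Z(G). Proof. by rewrite Zz finset.in_set2 eqxx orbT. Qed.

Lemma zG : z \in G. Proof. by case/centerP: zZ. Qed.

Lemma z_comm x : x \in G -> commute z x.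
Proof. by case/centerP: zZ => _; apply. Qed.

Lemma zX_comm x (b : bool) : x \in G -> commute (z ^+ b) x.
Proof. by move=> Gx; apply/commute_sym/commuteX/commute_sym/z_comm. Qed.

Lemma zz : z * z = 1.
Proof.
have /centerP[_ _] := zZ; have : z * z \in 'Z(G) by rewrite groupM ?zZ.
rewrite Zz finset.in_set2 => /orP[/eqP //|/eqP e].
by case/eqP: nz; apply: (mulgI z); rewrite e mulg1.
Qed.

Lemma zXD (a b : bool) : z ^+ a * z ^+ b = z ^+ (a (+) b).
Proof. by case: a b => [] []; rewrite ?expg0 ?expg1 ?mulg1 ?mul1g ?zz. Qed.

Lemma zX_inj (a b : bool) : z ^+ a = z ^+ b -> a = b.
Proof. by case: a b => [] [] // /eqP; rewrite ?[1 == _]eq_sym (negbTE nz). Qed.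

Lemma omC x y : om x y = om y x. Proof. by rewrite /om cent1C. Qed.

Lemma omxx x : om x x = false. Proof. by rewrite /om cent1id. Qed.

Lemma mulg_om x y : x \in G -> y \in G -> x * y = y * x * z ^+ om x y.
Proof.
move=> Gx Gy; rewrite -(gcg_om Gx Gy).
have -> : y * x * gcg x y = gcg x y * (y * x).
  rewrite gcg_om //; apply/commute_sym/zX_comm; exact: groupM.
by rewrite !mulgA mulgKV mulgKV.
Qed.

Lemma omM x y w : x \in G -> y \in G -> w \in G ->
  om (x * y) w = om x w (+) om y w.
Proof.
move=> Gx Gy Gw; apply: zX_inj; rewrite -zXD.
apply: (mulgI (w * (x * y))); rewrite -mulg_om ?groupM //.
rewrite -mulgA (mulg_om Gy Gw) !mulgA (mulg_om Gx Gw).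
by rewrite -!mulgA [_ * (y * _)]mulgA (zX_comm _ Gy) !mulgA.
Qed.

Lemma omX x w (b : bool) : om (x ^+ b) w = b && om x w.
Proof. by case: b; rewrite ?expg1 //= /om group1. Qed.

Lemma omV x w : om x^-1 w = om x w. Proof. by rewrite /om groupV. Qed.

Lemma omz w : w \in G -> om z w = false.
Proof. by move=> Gw; apply/negbTE; rewrite negbK; apply/cent1P/z_comm. Qed.

Lemma om_prod (I : Type) (r : seq I) (F : I -> gT) w :
  (forall i, F i \in G) -> w \in G ->
  om (\prod_(i <- r) F i) w = \big[addb/false]_(i <- r) om (F i) w.
Proof.
move=> FG Gw; elim: r => [|i r IHr]; first by rewrite !big_nil /om group1.
by rewrite !big_cons omM ?IHr // group_prod.
Qed.

Lemma om_word (I : finType) (x : I -> gT) u w :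
  (forall i, x i \in G) -> w \in G ->
  om (word x z u) w = bsum (fun i => u.1 i && om (x i) w).
Proof.
move=> xG Gw; have xuG i : x i ^+ u.1 i \in G by rewrite groupX.
rewrite /word omM ?groupX ?zG ?group_prod // omX omz // andbF addbF om_prod //.
by apply: eq_bigr => i _; rewrite omX.
Qed.

Lemma sqr_sq x : x \in G -> x * x = z ^+ sq x.
Proof.
move=> Gx; rewrite /sq expgS expg1.
have [->//|n1] := eqVneq (x * x) 1.
have : x * x \in 'Z(G).
  apply/centerP; rewrite groupM //; split=> // y Gy; apply/cent1P.
  by apply: negbFE; rewrite -/(om _ _) omM // addbb.
by rewrite Zz finset.in_set2 (negbTE n1) expg1 => /eqP.
Qed.

Lemma dualE (I : finType) (x y : I -> gT) :
  dual x y <-> forall i j, om (x i) (y j) = (i == j).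
Proof.
split=> xy i j; first by rewrite /om xy negbK.
by apply: negb_inj; rewrite -/(om _ _) xy negbK.
Qed.

End CommutatorForm.

(** * Dual families in rank 4 *)

Notation I2 := ('I_2 * bool)%type.
Notation j0 := (ord0 : 'I_2).
Notation j1 := (ord_max : 'I_2).

Lemma ord2_ind (P : 'I_2 -> Prop) : P j0 -> P j1 -> forall j, P j.
Proof.
move=> P0 P1 j; case: (unliftP j0 j) => [k|] -> //.
by rewrite (_ : lift j0 k = j1) //; apply: val_inj; rewrite /= ord1.
Qed.

Lemma I2_ind (P : I2 -> Prop) :
  P (j0, false) -> P (j0, true) -> P (j1, false) -> P (j1, true) ->
  forall i, P i.
Proof. by move=> P1 P2 P3 P4 [j s]; elim/ord2_ind: j; case: s. Qed.

Lemma enum_I2 : index_enum (Datatypes_prod__canonical__fintype_Finite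
    (fintype_ordinal__canonical__fintype_Finite 2)
    Datatypes_bool__canonical__fintype_Finite)
  = [:: (j0, true); (j0, false); (j1, true); (j1, false)].
Proof.
rewrite [LHS]unlock [Finite.enum]unlock -[LHS]/(prod_enum _ _) /prod_enum.
rewrite 2!enum_ordSl (size0nil (size_enum_ord 0)) enumT [Finite.enum]unlock /=.
by congr [:: (_, _); (_, _); (_, _); (_, _)]; apply: val_inj.
Qed.

Lemma big_I2 (F : I2 -> bool) :
  bsum F = F (j0, false) (+) F (j0, true) (+) F (j1, false) (+) F (j1, true).
Proof.
rewrite enum_I2 !big_cons big_nil.
by case: (F (j0, false)) (F (j0, true)) (F (j1, false)) (F (j1, true))
  => [] [] [] [].
Qed.

Section Pfaffian.
Variables (gT : finGroupType) (G : {group gT}) (z : gT).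
Hypotheses (esG : extraspecial G) (Zz : 'Z(G) = [set 1; z]%SET) (nz : z != 1).
Hypothesis oG : #|G| = 32%N.
Implicit Types (p q : I2 -> gT) (i k l : I2).

Lemma card_rank4 : #|G| = (2 ^ #|{: I2}|.+1)%N.
Proof. by rewrite oG card_prod card_ord card_bool. Qed.

(** The exponent of [z] in the product of commutators that appears in the
    surface relation of a strand with values [p]. *)
Definition surf p : bool :=
  om (p (j0, false)) (p (j0, true)) (+) om (p (j1, false)) (p (j1, true)).

Definition pfaffian p : bool :=
  om (p (j0, false)) (p (j0, true)) && om (p (j1, false)) (p (j1, true))
  (+) om (p (j0, false)) (p (j1, false)) && om (p (j0, true)) (p (j1, true))
  (+) om (p (j0, false)) (p (j1, true)) && om (p (j0, true)) (p (j1, false)).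

(** The entries of the Gram matrix of [p] on the complementary pairs of indices:
    for the Gram matrix M this is the matrix N with N M = pfaffian(M) Id. *)
Definition cogram p k i : bool :=
  if k.1 == i.1
  then (k.2 != i.2) && om (p (rev_ord k.1, false)) (p (rev_ord k.1, true))
  else om (p (k.1, ~~ k.2)) (p (i.1, ~~ i.2)).

Definition cofamily p k : gT := word p z ([ffun i => cogram p k i], false).

Lemma cofamily_in p k : (forall i, p i \in G) -> cofamily p k \in G.
Proof. by move=> pG; apply: word_closed => //; apply: zG Zz. Qed.

Lemma rev_ord2 : (rev_ord j0 = j1) * (rev_ord j1 = j0).
Proof. by split; apply: val_inj. Qed.

Lemma om_cofamily p k l : (forall i, p i \in G) ->
  om (cofamily p k) (p l) = pfaffian p && (k == l).
Proof.
move=> pG; rewrite (om_word esG Zz nz) //= big_I2 !ffunE /cogram.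
have oC i m := omC (p i) (p m).
elim/I2_ind: k; elim/I2_ind: l; rewrite /= !rev_ord2 ?omxx /pfaffian;
  rewrite ?(oC (j0, true) (j0, false)) ?(oC (j1, true) (j1, false))
    ?(oC (j1, false) (j0, _)) ?(oC (j1, true) (j0, _));
  by do 6?case: (om _ _).
Qed.

Lemma cofamily_dual p : (forall i, p i \in G) -> pfaffian p ->
  dual (cofamily p) p.
Proof. by move=> pG pfp; apply/dualE => k l; rewrite om_cofamily // pfp. Qed.

Lemma zcent p : (forall i, p i \in G) -> forall i, z \in 'C[p i].
Proof. by move=> pG i; apply/cent1P/(z_comm Zz). Qed.

(** If the pfaffian vanished, the cofamily would commute with [p], which
    generates [G]; pairing it with [q] would kill the whole Gram matrix. *)
Lemma dual_pfaffian p q :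
    (forall i, p i \in G) -> (forall i, q i \in G) -> dual p q -> surf p ->
  pfaffian p.
Proof.
move=> pG qG dpq sp; apply: contraTT sp => /negbTE pf0.
have K0 k i : cogram p k i = false.
  have <- : om (cofamily p k) (q i) = cogram p k i.
    rewrite (om_word esG Zz nz) //= (bigD1 i) //= ffunE.
    rewrite (dualE _ _).1 // eqxx andbT big1 ?addbF // => l nli.
    by rewrite (dualE _ _).1 // (negbTE nli) andbF.
  have [w ->] := word_onto dpq (zcent qG) nz pG (zG Zz) card_rank4 (qG i).
  rewrite omC (om_word esG Zz nz) ?cofamily_in // big1 // => l _.
  by rewrite omC om_cofamily // pf0 andbF.
have := K0 (j0, false) (j0, true); have := K0 (j1, false) (j1, true).
by rewrite /cogram /= !rev_ord2 /surf => -> ->.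
Qed.

Definition duals p j : {set gT} :=
  [set g in G | [forall l, om g (p l) == (j == l)]]%SET.

Lemma duals_cofamily p j : (forall i, p i \in G) -> pfaffian p ->
  duals p j = [set cofamily p j; z * cofamily p j]%SET.
Proof.
move=> pG pfp; have cG := cofamily_in j pG; have zG := zG Zz.
apply/setP=> g; rewrite finset.in_set2 finset.inE.
apply/andP/orP=> [[Gg /forallP dg]|[/eqP->|/eqP->]].
- have [||h|h] := dual_cent (cofamily_dual pG pfp) (zcent pG) nz
      (fun k => cofamily_in k pG) zG card_rank4 (g := g * (cofamily p j)^-1).
  + by rewrite groupM ?groupV.
  + move=> l; apply: negbFE; rewrite -/(om _ _).
    rewrite (omM esG Zz nz) ?groupV // omV om_cofamily // pfp.
    by rewrite (eqP (dg l)) addbb.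
  + by left; apply/eqP/(mulIg (cofamily p j)^-1); rewrite h mulgV.
  + by right; apply/eqP/(mulIg (cofamily p j)^-1); rewrite h mulgK.
- by split=> //; apply/forallP=> l; rewrite om_cofamily // pfp.
- split; first by rewrite groupM.
  apply/forallP=> l; rewrite (omM esG Zz nz) // (omz Zz) //.
  by rewrite om_cofamily // pfp.
Qed.

Lemma card_duals p j : (forall i, p i \in G) -> pfaffian p -> #|duals p j| = 2%N.
Proof.
move=> pG pfp; rewrite duals_cofamily // cards2.
by rewrite -[X in X != _]mul1g (inj_eq (mulIg _)) eq_sym nz.
Qed.

(** The dual family has the inverse Gram matrix, in which the entries at the two
    pairs of indices that [surf] involves are exchanged. Hence the second surface
    relation follows from the first. *)
Lemma dual_surf p (q : I2 -> gT) : (forall i, p i \in G) -> pfaffian p ->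
  (forall j, q j \in duals p j) -> surf q = surf p.
Proof.
move=> pG pfp dq.
have qG j : q j \in G by have := dq j; rewrite finset.inE => /andP[].
have oq j k : om (q j) (q k) = cogram p j k.
  have -> : om (q j) (q k) = om (cofamily p j) (q k).
    have := dq j; rewrite duals_cofamily // => /set2P[->|->] //.
    by rewrite (omM esG Zz nz) ?cofamily_in ?(zG Zz) // (omz Zz).
  rewrite (om_word esG Zz nz) //= (bigD1 k) //= ffunE.
  have pq l : om (p l) (q k) = (k == l).
    by rewrite omC; have := dq k; rewrite finset.inE => /andP[_ /forallP/(_ l)/eqP].
  rewrite pq eqxx andbT big1 ?addbF // => l nlk.
  by rewrite pq eq_sym (negbTE nlk) andbF.
by rewrite /surf !oq /cogram /= !rev_ord2 addbC.
Qed.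

(** With [A12] sent to [z], these are the values on the two strands that satisfy
    the braid relations. *)
Definition adm_pairs : {set {ffun I2 -> gT} * {ffun I2 -> gT}} :=
  [set pq : {ffun I2 -> gT} * {ffun I2 -> gT} |
     [&& [forall i, pq.1 i \in G], [forall i, pq.2 i \in G],
     [forall i, forall j, om (pq.1 i) (pq.2 j) == (i == j)],
     surf pq.1 & surf pq.2]]%SET.

Definition adm_first : {set {ffun I2 -> gT}} :=
  [set p : {ffun I2 -> gT} | [&& [forall i, p i \in G], surf p & pfaffian p]]%SET.

Lemma adm_pairsE (p q : {ffun I2 -> gT}) : ((p, q) \in adm_pairs) =
  (p \in adm_first) && (q \in family (fun j => mem (duals p j))).
Proof.
rewrite [LHS]finset.inE [p \in _]finset.inE /=; apply/and5P/andP.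
  case=> /forallP pG /forallP qG /forallP pq sp sq; split.
    apply/and3P; split=> //; first exact/forallP.
    apply: (dual_pfaffian pG qG) => //; apply/dualE => i j.
    by have /forallP/(_ j)/eqP := pq i.
  apply/familyP=> j; rewrite finset.inE qG; apply/forallP=> l.
  by rewrite omC eq_sym [j == l]eq_sym; have /forallP/(_ j) := pq l; rewrite eq_sym.
case=> /and3P[/forallP pG sp pfp] /familyP qd; split=> //.
- exact/forallP.
- by apply/forallP=> j; have := qd j; rewrite finset.inE => /andP[].
- apply/forallP=> i; apply/forallP=> j; have := qd j.
  by rewrite finset.inE omC [i == j]eq_sym => /andP[_ /forallP/(_ i)].
- by rewrite (dual_surf pG).
Qed.

Lemma card_adm_pairs : #|adm_pairs| = (#|adm_first| * 16)%N.
Proof.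
rewrite -sum1_card.
rewrite (eq_bigl (fun pq : {ffun I2 -> gT} * {ffun I2 -> gT} =>
    (pq.1 \in adm_first) &&
    (pq.2 \in family (fun j => mem (duals pq.1 j))))); last first.
  by case=> p q; rewrite adm_pairsE.
rewrite -(pair_big_dep (fun p : {ffun I2 -> gT} => p \in adm_first)
  (fun p q : {ffun I2 -> gT} => q \in family (fun j => mem (duals p j)))
  (fun _ _ => 1%N)) /=.
rewrite -sum_nat_const; apply: eq_bigr => p.
rewrite finset.inE => /and3P[/forallP pG sp pfp]; rewrite sum1_card card_family.
rewrite foldrE big_image /= (eq_bigr (fun=> 2%N)) => [|j _]; last exact: card_duals.
by rewrite prod_nat_const card_prod card_ord card_bool.
Qed.

End Pfaffian.

(** * Counting families in coordinates *)

Local Notation quad T := (T * T * T * T)%type.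

Section Enumeration.


Definition quads (T : Type) (s : seq T) : seq (quad T) :=
  [seq (x, d) | x <- [seq (x, c) | x <- [seq (a, b) | a <- s, b <- s], c <- s],
                d <- s].

Lemma pairs_enum (S T : finType) (s : seq S) (t : seq T) :
    uniq s -> s =i predT -> uniq t -> t =i predT ->
  uniq [seq (x, y) | x <- s, y <- t] /\ [seq (x, y) | x <- s, y <- t] =i predT.
Proof.
move=> us es ut et; split; first by apply: allpairs_uniq => // -[? ?] [? ?].
by move=> [x y]; rewrite (allpairs_f (fun x y => (x, y))) ?es ?et.
Qed.

Lemma quads_enum (T : finType) (s : seq T) :
  uniq s -> s =i predT -> uniq (quads s) /\ quads s =i predT.
Proof.
move=> us es; have [u2 e2] := pairs_enum us es us es.
have [u3 e3] := pairs_enum u2 e2 us es; exact: pairs_enum.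
Qed.

Lemma card_count (T : finType) (s : seq T) (P : pred T) :
  uniq s -> s =i predT -> #|[set x | P x]%SET| = count P s.
Proof.
move=> us es; rewrite -size_filter -(card_uniqP _) ?filter_uniq //.
by apply: eq_card => x; rewrite finset.inE mem_filter es andbT.
Qed.

Definition quad_of_ffun (T : Type) (m : {ffun I2 -> T}) : quad T :=
  (m (j0, false), m (j0, true), m (j1, false), m (j1, true)).

Definition ffun_of_quad (T : Type) (x : quad T) : {ffun I2 -> T} :=
  [ffun i : I2 => let: (a, b, c, d) := x in
     if i.1 == j0 then if i.2 then b else a else if i.2 then d else c].

Lemma quad_of_ffunK T : cancel (@quad_of_ffun T) (@ffun_of_quad T).
Proof. by move=> m; apply/ffunP; elim/I2_ind; rewrite ffunE. Qed.

Lemma ffun_of_quadK T : cancel (@ffun_of_quad T) (@quad_of_ffun T).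
Proof. by move=> [[[a b] c] d]; rewrite /quad_of_ffun !ffunE. Qed.

Local Notation vect := {ffun I2 -> bool}.

Definition quads_of_vects (m : {ffun I2 -> vect}) : quad (quad bool) :=
  quad_of_ffun [ffun i => quad_of_ffun (m i)].

Lemma quads_of_vects_bij : bijective quads_of_vects.
Proof.
exists (fun x => [ffun i => ffun_of_quad (ffun_of_quad x i)]).
  move=> m; apply/ffunP=> i; rewrite ffunE /quads_of_vects quad_of_ffunK.
  by rewrite ffunE quad_of_ffunK.
move=> x; rewrite /quads_of_vects -[RHS]ffun_of_quadK; congr quad_of_ffun.
by apply/ffunP=> i; rewrite !ffunE ffun_of_quadK.
Qed.

Definition bool_quads := quads [:: true; false].

(** Turns the number of families of four vectors with a given property into a
    count over an explicit list of 16 ^ 4 of them. *)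
Lemma card_vect_families (P : pred {ffun I2 -> vect}) (Q : pred (quad (quad bool))) :
  (forall m, P m = Q (quads_of_vects m)) ->
  #|[set m | P m]%SET| = count Q (quads bool_quads).
Proof.
move=> PQ; have [u1 e1] : uniq bool_quads /\ bool_quads =i predT.
  by apply: quads_enum => // -[].
have [u2 e2] := quads_enum u1 e1; rewrite -(card_count _ u2 e2).
rewrite -(on_card_preimset (onW_bij _ quads_of_vects_bij)).
by apply: eq_card => m; rewrite !finset.inE PQ.
Qed.

(** The standard symplectic form, and the quadratic form that refines it and
    takes the values [e] on the standard basis. *)
Definition sform (u v : quad bool) : bool :=
  let: (a, b, c, d) := u in let: (a', b', c', d') := v in
  (a && b') (+) (b && a') (+) ((c && d') (+) (d && c')).

Definition qform (e u : quad bool) : bool :=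
  let: (x, y, v, w) := e in let: (a, b, c, d) := u in
  (a && x) (+) (b && y) (+) (c && v) (+) (d && w) (+) (a && b) (+) (c && d).

Lemma sformxx u : sform u u = false.
Proof. by case: u => [[[[] []] []] []]. Qed.

Lemma sformC u v : sform u v = sform v u.
Proof.
by case: u v => [[[[] []] []] []] [[[[] []] []] []].
Qed.

Definition first_strand_test (m : quad (quad bool)) : bool :=
  let: (a, b, c, d) := m in
  (sform a b (+) sform c d) &&
  (sform a b && sform c d (+) sform a c && sform b d (+) sform a d && sform b c).


(** Of the 28 invertible alternating matrices of rank 4 over the field with two
    elements, 12 have distinct entries at the two pairs of indices; each is the
    Gram matrix of 720 bases, 720 being the order of the symplectic group. *)
Lemma count_first_strand : count first_strand_test (quads bool_quads) = (12 * 720)%N.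
Proof. by []. Qed.

Definition basis_test (e : quad bool) (m : quad (quad bool)) : bool :=
  let: (a, b, c, d) := m in let: (x, y, v, w) := e in
  [&& qform e a == x, qform e b == y, qform e c == v, qform e d == w,
      sform a b, sform c d, ~~ sform a c, ~~ sform a d, ~~ sform b c
    & ~~ sform b d].

(** The orders of the orthogonal groups of the two non-degenerate quadratic
    forms. *)
Lemma count_basis_H5 :
  count (basis_test (false, false, false, false)) (quads bool_quads) = 72%N.
Proof. by []. Qed.

Lemma count_basis_G5 :
  count (basis_test (false, false, true, true)) (quads bool_quads) = 120%N.
Proof. by []. Qed.

End Enumeration.

Section Coordinates.
Variables (gT : finGroupType) (G : {group gT}) (z : gT).
Hypotheses (esG : extraspecial G) (Zz : 'Z(G) = [set 1; z]%SET) (nz : z != 1).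
Hypothesis oG : #|G| = 32%N.

Definition flip (i : I2) : I2 := (i.1, ~~ i.2).

Definition symplectic (p : I2 -> gT) : Prop :=
  (forall i, p i \in G) /\ (forall i k, om (p i) (p k) = (k == flip i)).

Lemma flipK : involutive flip.
Proof. by case=> j s; rewrite /flip negbK. Qed.

Lemma symplectic_dual p : symplectic p -> dual p (p \o flip).
Proof.
by case=> pG pp; apply/dualE => i k; rewrite pp (can_eq flipK) eq_sym.
Qed.

Variable p : I2 -> gT.
Hypothesis sp : symplectic p.
Let pG : forall i, p i \in G := sp.1.
Let pG' i : (p \o flip) i \in G. Proof. exact: pG. Qed.

Lemma symplectic_word_inj : injective (word p z).
Proof. exact: word_inj (symplectic_dual sp) (zcent Zz pG') nz. Qed.

Lemma symplectic_word_onto g : g \in G -> exists w, g = word p z w.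
Proof.
exact: (word_onto (symplectic_dual sp) (zcent Zz pG') nz pG (zG Zz)
  (card_rank4 oG)).
Qed.

Lemma symplectic_word_in w : word p z w \in G.
Proof. exact: word_closed (zG Zz). Qed.

Lemma om_words u v :
  om (word p z u) (word p z v) = sform (quad_of_ffun u.1) (quad_of_ffun v.1).
Proof.
rewrite (om_word esG Zz nz) ?symplectic_word_in // big_I2 /=.
have pv i : om (p i) (word p z v) = v.1 (flip i).
  rewrite omC (om_word esG Zz nz) // (bigD1 (flip i)) //=.
  rewrite omC sp.2 eqxx andbT big1 ?addbF // => k nk.
  by rewrite omC sp.2 (negbTE nk) andbF.
by rewrite !pv !addbA.
Qed.

Definition family_of_words (m : {ffun I2 -> {ffun I2 -> bool} * bool}) :
  {ffun I2 -> gT} := [ffun i => word p z (m i)].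

(** Families in [G] correspond to families of vectors together with a lift of
    each vector, that is, a choice of sign. *)
Lemma card_families (P : pred {ffun I2 -> gT}) (Q : pred (quad (quad bool))) :
    (forall m, P (family_of_words m) =
       Q (quads_of_vects [ffun i => (m i).1])) ->
  #|[set x : {ffun I2 -> gT} | [forall i, x i \in G] && P x]%SET|
    = (count Q (quads bool_quads) * 16)%N.
Proof.
move=> PQ; rewrite -(@card_vect_families (fun u => Q (quads_of_vects u)) Q) //.
set U := [set u | _]%SET.
pose split (m : {ffun I2 -> {ffun I2 -> bool} * bool}) :
    {ffun I2 -> {ffun I2 -> bool}} * {ffun I2 -> bool} :=
  ([ffun i => (m i).1], [ffun i => (m i).2]).
pose merge (us : {ffun I2 -> {ffun I2 -> bool}} * {ffun I2 -> bool}) :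
    {ffun I2 -> {ffun I2 -> bool} * bool} := [ffun i => (us.1 i, us.2 i)].
have splitK : cancel split merge.
  by move=> m; apply/ffunP=> i; rewrite !ffunE /=; case: (m i).
have mergeK : cancel merge split.
  by case=> u s; congr (_, _); apply/ffunP=> i; rewrite !ffunE.
have -> : 16%N = #|[set: {ffun I2 -> bool}]%SET|.
  by rewrite cardsT card_ffun card_bool card_prod card_ord card_bool.
have bij : bijective split by exists merge.
rewrite -cardsX -(on_card_preimset (onW_bij _ bij)).
have inj : injective family_of_words.
  move=> m m' e; apply/ffunP=> i; apply: symplectic_word_inj.
  by have := congr1 (fun h : {ffun I2 -> gT} => h i) e; rewrite !ffunE.
rewrite -(card_imset _ inj); apply: eq_card => x; rewrite finset.inE.
apply/andP/imsetP=> [[/forallP xG Px]|[m]].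
  have [w xw] : exists m, x = family_of_words m.
    have [m em] := boolp.choice (fun i => symplectic_word_onto (xG i)).
    by exists (finfun m); apply/ffunP=> i; rewrite !ffunE -em.
  exists w => //; rewrite xw PQ in Px.
  by rewrite finset.inE finset.in_setX finset.in_setT finset.inE Px.
rewrite finset.inE finset.in_setX finset.in_setT finset.inE andbT => Qm ->.
rewrite PQ Qm; split=> //; apply/forallP=> i; rewrite ffunE.
exact: symplectic_word_in.
Qed.

Lemma card_adm_first : #|adm_first G| = (12 * 720 * 16)%N.
Proof.
rewrite -count_first_strand -(@card_families (fun x => surf x && pfaffian x)).
  by apply: eq_card => x; rewrite !finset.inE.
move=> m; rewrite /surf /pfaffian /family_of_words !ffunE !om_words.
by rewrite /first_strand_test /quads_of_vects /quad_of_ffun !ffunE.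
Qed.

(** ** Multiplication of words *)

(** The sign produced when two normal forms are multiplied: squares of
    generators, and generators moved past each other. *)
Fixpoint cocycle (I : Type) (e : I -> bool) (o : I -> I -> bool) (s : seq I)
    (u v : I -> bool) : bool :=
  if s is i :: r then
    (u i && v i && e i) (+) (v i && \big[addb/false]_(k <- r) (u k && o k i))
      (+) cocycle e o r u v
  else false.

Lemma prodX_mul (I : Type) (x : I -> gT) (s : seq I) (u v : I -> bool) :
    (forall i, x i \in G) ->
  (\prod_(i <- s) x i ^+ u i) * (\prod_(i <- s) x i ^+ v i) =
  (\prod_(i <- s) x i ^+ (u i (+) v i))
  * z ^+ cocycle (fun i => sq (x i)) (fun i k => om (x i) (x k)) s u v.
Proof.
move=> xG; have PG (r : seq I) (w : I -> bool) : \prod_(i <- r) x i ^+ w i \in G.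
  by rewrite group_prod // => i _; rewrite groupX.
elim: s => [|i r IHr]; first by rewrite !big_nil !mulg1.
rewrite !big_cons /=.
have -> : x i ^+ u i * \prod_(k <- r) x k ^+ u k
    * (x i ^+ v i * \prod_(k <- r) x k ^+ v k) =
  x i ^+ u i * x i ^+ v i * (\prod_(k <- r) x k ^+ u k
    * \prod_(k <- r) x k ^+ v k)
    * z ^+ (v i && \big[addb/false]_(k <- r) (u k && om (x k) (x i))).
  have -> : v i && \big[addb/false]_(k <- r) (u k && om (x k) (x i))
      = om (\prod_(k <- r) x k ^+ u k) (x i ^+ v i).
    rewrite omC omX omC (om_prod esG Zz nz) //; last by move=> k; rewrite groupX.
    by congr (_ && _); apply: eq_bigr => k _; rewrite omX.
  rewrite -!mulgA; congr (_ * _).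
  rewrite !mulgA (mulg_om esG Zz (PG r u) (groupX _ (xG i))) -!mulgA.
  by congr (_ * (_ * _)); apply: (zX_comm Zz).
rewrite IHr; have -> : x i ^+ u i * x i ^+ v i =
    x i ^+ (u i (+) v i) * z ^+ (u i && v i && sq (x i)).
  case: (u i) (v i) => -[]; rewrite ?expg0 ?expg1 ?mulg1 ?mul1g //.
  by rewrite /= (sqr_sq esG Zz nz).
set a := (u i && _ && _); set b := (v i && _); set c := cocycle _ _ _ _ _.
rewrite -!(zXD Zz nz) -!mulgA; congr (_ * _); rewrite !mulgA.
rewrite (zX_comm Zz a) // -!mulgA; congr (_ * (_ * _)).
by rewrite !(zXD Zz nz) addbC.
Qed.

Lemma word_mul (I : finType) (x : I -> gT) w w' : (forall i, x i \in G) ->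
  word x z w * word x z w' = word x z ([ffun i => w.1 i (+) w'.1 i],
    cocycle (fun i => sq (x i)) (fun i k => om (x i) (x k)) (index_enum I) w.1 w'.1
    (+) (w.2 (+) w'.2)).
Proof.
move=> xG; rewrite /word /= -!mulgA.
have PG (v : I -> bool) : \prod_i x i ^+ v i \in G.
  by rewrite group_prod // => i _; rewrite groupX.
rewrite [z ^+ _ * _]mulgA (zX_comm Zz) // !mulgA prodX_mul //.
rewrite -!mulgA !(zXD Zz nz); congr (_ * _).
by apply: eq_bigr => i _; rewrite ffunE.
Qed.

Lemma sq_word w : sq (word p z w) =
  qform (quad_of_ffun [ffun i => sq (p i)]) (quad_of_ffun w.1).
Proof.
apply: (zX_inj nz); rewrite -(sqr_sq esG Zz nz) ?symplectic_word_in //.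
rewrite word_mul // addbb addbF /word /= big1 ?mul1g => [|i _]; last first.
  by rewrite ffunE addbb.
congr (z ^+ (nat_of_bool _)); rewrite enum_I2 /= !big_cons !big_nil /=.
rewrite !sp.2 /quad_of_ffun !ffunE /=.
case: w => u e /=; do 4?[case: (u _)]; do 4?case: (sq _); by [].
Qed.

Definition symplectic_like (x : {ffun I2 -> gT}) : bool :=
  [forall i, forall k, om (x i) (x k) == (k == flip i)]
  && [forall i, sq (x i) == sq (p i)].

Definition symplectic_set : {set {ffun I2 -> gT}} :=
  [set x : {ffun I2 -> gT} | [forall i, x i \in G] && symplectic_like x]%SET.

Lemma card_symplectic_set : #|symplectic_set| =
  (count (basis_test (quad_of_ffun [ffun i => sq (p i)])) (quads bool_quads) * 16)%N.
Proof.
apply: card_families => m; rewrite /symplectic_like /quads_of_vects.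
have E (F : I2 -> bool) : [forall i, F i] =
    [&& F (j0, false), F (j0, true), F (j1, false) & F (j1, true)].
  apply/forallP/and4P=> [h|[h1 h2 h3 h4]]; first by split; apply: h.
  by elim/I2_ind.
rewrite !E /family_of_words !ffunE !om_words !sq_word.
rewrite [quad_of_ffun [ffun i => quad_of_ffun _]]/quad_of_ffun !ffunE.
rewrite [quad_of_ffun [ffun i => sq (p i)]]/quad_of_ffun !ffunE /basis_test.
set e := (_, _, _, _).
move: (quad_of_ffun _) (quad_of_ffun _) (quad_of_ffun _) (quad_of_ffun _).
move=> d c b a.
rewrite !sformxx (sformC b a) (sformC c a) (sformC d a).
rewrite (sformC c b) (sformC d b) (sformC d c).
move: (sform a b) (sform a c) (sform a d) (sform b c) (sform b d) (sform c d).
move: (qform e a == _) (qform e b == _) (qform e c == _) (qform e d == _).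
by do 10!case.
Qed.

End Coordinates.

(** * Automorphisms *)

Section Automorphisms.
Variables (gT : finGroupType) (G : {group gT}) (z : gT).
Hypotheses (esG : extraspecial G) (Zz : 'Z(G) = [set 1; z]%SET) (nz : z != 1).
Hypothesis oG : #|G| = 32%N.
Implicit Types (a : {perm gT}) (x y : gT).

Lemma autX a x : a \in Aut G -> (x \in G) = (a x \in G).
Proof.
move=> Aa; apply/idP/idP=> [|Gax]; first exact: Aut_closed.
by rewrite -(permK a x) Aut_closed ?groupV.
Qed.

Lemma autM a x y : a \in Aut G -> x \in G -> y \in G -> a (x * y) = a x * a y.
Proof. by move=> Aa Gx Gy; have /morphicP-> := Aut_morphic Aa. Qed.

Lemma aut1 a : a \in Aut G -> a 1 = 1.
Proof. by move=> Aa; rewrite -(autmE Aa) morph1. Qed.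

Lemma aut_om a x y : a \in Aut G -> x \in G -> y \in G ->
  om (a x) (a y) = om x y.
Proof.
move=> Aa Gx Gy; congr negb; apply/cent1P/cent1P=> c.
  by apply: (@perm_inj _ a); rewrite !autM.
by rewrite /commute -!autM // c.
Qed.

Lemma aut_sq a x : a \in Aut G -> x \in G -> sq (a x) = sq x.
Proof.
move=> Aa Gx; rewrite /sq !(expgS _ 1) !expg1 -autM // -{1}(aut1 Aa).
by rewrite (inj_eq perm_inj).
Qed.

Lemma aut_z a : a \in Aut G -> a z = z.
Proof.
move=> Aa; have : a z \in 'Z(G).
  apply/centerP; rewrite -autX ?(zG Zz) //; split=> // y Gy.
  rewrite -[y](permKV a) /commute -!autM ?(zG Zz) ?Aut_closed ?groupV //.
  by rewrite (z_comm Zz) ?Aut_closed ?groupV.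
rewrite Zz finset.in_set2 => /orP[/eqP|/eqP //].
by rewrite -{1}(aut1 Aa) => /perm_inj z1; have := nz; rewrite z1 eqxx.
Qed.

Lemma aut_word a (x : I2 -> gT) w : a \in Aut G -> (forall i, x i \in G) ->
  a (word x z w) = word (a \o x) z w.
Proof.
move=> Aa xG; have xuG i : x i ^+ w.1 i \in G by rewrite groupX.
have aX y (b : bool) : y \in G -> a (y ^+ b) = a y ^+ b.
  by move=> Gy; rewrite -!(autmE Aa) morphX.
rewrite /word autM ?group_prod ?groupX ?(zG Zz) // aX ?(zG Zz) // aut_z //.
congr (_ * _); rewrite -(autmE Aa) morph_prod //.
by apply: eq_bigr => i _; rewrite /= autmE aX.
Qed.

Variable p : I2 -> gT.
Hypothesis sp : symplectic G p.
Let pG : forall i, p i \in G := sp.1.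

Definition aut_family a : {ffun I2 -> gT} := [ffun i => a (p i)].

Lemma aut_family_inj : {in Aut G &, injective aut_family}.
Proof.
move=> a b Aa Ab /= e; apply: (eq_Aut Aa Ab) => g Gg.
have [w ->] := symplectic_word_onto Zz nz oG sp Gg.
rewrite !aut_word //; congr (_ * _); apply: eq_bigr => i _; congr (_ ^+ _) => /=.
by have := congr1 (fun h : {ffun I2 -> gT} => h i) e; rewrite !ffunE.
Qed.

(** Two symplectic families with the same squares have the same multiplication
    table of normal forms, so that an automorphism maps one to the other. *)
Lemma aut_family_onto (x : {ffun I2 -> gT}) : x \in symplectic_set G p ->
  exists2 a, a \in Aut G & x = aut_family a.
Proof.
rewrite finset.inE => /and3P[/forallP xG /forallP xo /forallP xs].
have sx : symplectic G x.
  by split=> // i k; have /forallP/(_ k)/eqP := xo i.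
pose m g := word x z (odflt ([ffun=> false], false) [pick w | word p z w == g]).
have mw w : m (word p z w) = word x z w.
  rewrite /m; case: pickP => [w' /eqP|/(_ w)]; last by rewrite eqxx.
  by move/(symplectic_word_inj Zz nz sp)->.
have mM : {in G &, {morph m : g h / g * h}}.
  move=> g h Gg Gh; have [w ->] := symplectic_word_onto Zz nz oG sp Gg.
  have [w' ->] := symplectic_word_onto Zz nz oG sp Gh.
  rewrite (word_mul esG Zz nz) // !mw (word_mul esG Zz nz) //.
  have -> : (fun i => sq (x i)) = (fun i => sq (p i)).
    by apply: funext => i; exact: (eqP (xs i)).
  suff -> : (fun i k => om (x i) (x k)) = (fun i k => om (p i) (p k)) by [].
  by apply: funext => i; apply: funext => k; rewrite sx.2 sp.2.
pose mm : {morphism G >-> gT} := Morphism mM.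
have minj : 'injm mm.
  apply/injmP=> g h Gg Gh; have [w ->] := symplectic_word_onto Zz nz oG sp Gg.
  have [w' ->] := symplectic_word_onto Zz nz oG sp Gh.
  by rewrite /= !mw => /(symplectic_word_inj Zz nz sx)->.
have mG : mm @* G = G.
  apply/eqP; rewrite finset.eqEcard card_injm // leqnn andbT.
  apply/fintype.subsetP=> _ /morphimP[g _ _ ->].
  exact: (symplectic_word_in Zz sx).
exists (aut minj mG); first exact: Aut_aut.
apply/ffunP=> i; rewrite ffunE autE //=.
have pw (y : I2 -> gT) : y i = word y z ([ffun k => k == i], false).
  rewrite /word mulg1 /=; transitivity (\prod_(k | k == i) y k).
    by rewrite big_pred1_eq.
  by rewrite big_mkcond; apply: eq_bigr => k _; rewrite ffunE; case: (k == i).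
by rewrite (pw p) mw -pw.
Qed.

Lemma card_Aut : #|Aut G| = #|symplectic_set G p|.
Proof.
rewrite -(card_in_imset aut_family_inj); apply: eq_card => x.
apply/imsetP/idP=> [[a Aa ->]|/aut_family_onto[a Aa ->]]; last by exists a.
rewrite finset.inE; apply/and3P; split; apply/forallP=> i.
- by rewrite ffunE Aut_closed.
- by apply/forallP=> k; rewrite !ffunE aut_om // sp.2.
- by rewrite !ffunE aut_sq.
Qed.

End Automorphisms.

(** * Admissible epimorphisms in genus 2 *)

Section GenusTwo.
Variables (gT : finGroupType) (G : {group gT}) (z : gT).
Hypotheses (esG : extraspecial G) (Zz : 'Z(G) = [set 1; z]%SET) (nz : z != 1).
Hypothesis oG : #|G| = 32%N.
Local Notation pair := ({ffun I2 -> gT} * {ffun I2 -> gT})%type.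
Implicit Types (pq : pair) (phi : P2 2 -> gT).

Definition assign pq (g : braid_gen 2) : gT :=
  match g with
  | gen_rho1 j => pq.1 (j, false)
  | gen_tau1 j => pq.1 (j, true)
  | gen_rho2 j => pq.2 (j, true)
  | gen_tau2 j => pq.2 (j, false)
  | gen_A12 => z
  end.

Definition epi_of pq : P2 2 -> gT := pres_lift (@braid_rel 2) (assign pq).

Lemma zV : z^-1 = z.
Proof. by apply: (mulgI z); rewrite mulgV (zz Zz nz). Qed.

Lemma gcg_omV x y : x \in G -> y \in G -> gcg x^-1 y = z ^+ om x y.
Proof. by move=> Gx Gy; rewrite (gcg_om esG Zz) ?groupV // omV. Qed.

Lemma gcg_omVV x y : x \in G -> y \in G -> gcg x^-1 y^-1 = z ^+ om x y.
Proof.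
by move=> Gx Gy; rewrite (gcg_om esG Zz) ?groupV // omV omC omV omC.
Qed.

Lemma lift_ord2 : lift j0 ord0 = j1.
Proof. exact: val_inj. Qed.

Lemma signed_cancel (a b : bool) x y : x \in G -> y \in G ->
  z ^+ a * x^-1 * (z ^+ b * y^-1) * (y * x) = z ^+ (a (+) b).
Proof.
move=> Gx Gy; rewrite -(zXD Zz nz) -!mulgA; congr (_ * _).
by rewrite [y^-1 * _]mulgA mulVg mul1g (zX_comm Zz b Gx) mulKg.
Qed.

(** As commutators are central, the conjugates of the two generators [tau] that
    occur in a surface relation cancel, leaving the product of commutators. *)
Lemma eval_surface1 (f : braid_gen 2 -> gT) : (forall g, f g \in G) ->
  eval f (prod_down (fun j => [(GGen (gen_rho1 j))^-1, (GGen (gen_tau1 j))^-1]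
                             * (GGen (gen_tau1 j))^-1)
     * prod_up (fun j => GGen (gen_tau1 j)))%gx = z ^+ surf (strand1 f).
Proof.
move=> fG; rewrite /prod_down /prod_up !big_ord_recl !big_ord0 /=.
rewrite lift_ord2 !rev_ord2 !mulg1 !gcg_omVV // signed_cancel //.
by rewrite /surf addbC.
Qed.

Lemma eval_surface2 (f : braid_gen 2 -> gT) : (forall g, f g \in G) ->
  eval f (prod_up (fun j => [(GGen (gen_rho2 j))^-1, GGen (gen_tau2 j)]
                            * GGen (gen_tau2 j))
     * prod_down (fun j => (GGen (gen_tau2 j))^-1))%gx = z ^+ surf (strand2 f).
Proof.
move=> fG; rewrite /prod_down /prod_up !big_ord_recl !big_ord0 /=.
rewrite lift_ord2 !rev_ord2 !mulg1 !gcg_omV //.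
set a := om _ _; set b := om _ _.
have := @signed_cancel a b (f (gen_tau2 j0))^-1 (f (gen_tau2 j1))^-1.
rewrite !groupV !invgK => -> //.
by rewrite /a /b /surf /= ![om (f (gen_rho2 _)) _]omC.
Qed.

Lemma assign_in pq g : (forall i, pq.1 i \in G) -> (forall i, pq.2 i \in G) ->
  assign pq g \in G.
Proof. by move=> pG qG; case: g => [j|j|j|j|] /=; rewrite ?(zG Zz). Qed.

Lemma adm_pairP pq : reflect
  [/\ forall i, pq.1 i \in G, forall i, pq.2 i \in G,
      forall i j, om (pq.1 i) (pq.2 j) = (i == j), surf pq.1 & surf pq.2]
  (pq \in adm_pairs G).
Proof.
rewrite finset.inE; apply: (iffP and5P) => -[pG qG pq12 s1 s2]; split=> //.
- exact/forallP.
- exact/forallP.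
- by move=> i j; have /forallP/(_ i)/forallP/(_ j)/eqP := pq12.
- exact/forallP.
- exact/forallP.
- by apply/forallP=> i; apply/forallP=> j; apply/eqP.
Qed.

Lemma assign_rel pq : pq \in adm_pairs G ->
  forall x y, braid_rel x y -> eval (assign pq) x = eval (assign pq) y.
Proof.
case/adm_pairP=> pG qG pq12 s1 s2.
have fG g := assign_in g pG qG.
have g12 i j : gcg (pq.1 i) (pq.2 j) = z ^+ (i == j).
  by rewrite (gcg_om esG Zz) // pq12.
have zq j : commute z (pq.2 j) by apply: (z_comm Zz).
have g1z i : gcg (pq.1 i) z = 1 by apply/gcg_eq1/commute_sym/(z_comm Zz).
have gqz j : gcg (pq.2 j)^-1 z = 1.
  by apply/gcg_eq1/commute_sym/(z_comm Zz); rewrite groupV.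
have gzq j : gcg z (pq.2 j) = 1 by apply/gcg_eq1.
have cz j : (pq.2 j)^-1 * z * pq.2 j = z by apply/commute_conj/commute_sym.
have zxz x : x \in G -> z * x * z = x.
  by move=> Gx; rewrite (z_comm Zz Gx) -mulgA (zz Zz nz) mulg1.
have ltF (j k : 'I_2) : (j < k)%N -> (j == k) = false.
  by move=> ljk; apply/negbTE; rewrite neq_ltn ljk.
have gtF (j k : 'I_2) : (k < j)%N -> (j == k) = false.
  by move=> lkj; apply/negbTE; rewrite neq_ltn lkj orbT.
move=> x y; case=> {x y} [||j k ljk|j|j k lkj|j k ljk|j|j k lkj|j|j k ljk|j
  |j k lkj|j k ljk|j|j k lkj|j]; rewrite ?eval_surface1 ?eval_surface2 //=;
  rewrite ?g12 ?g1z ?gqz ?zV ?gzq ?cz ?xpair_eqE ?eqxx ?andbT ?andbF //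
    ?(ltF _ _ ljk) ?(gtF _ _ lkj) //.
- by rewrite -[surf _]/(surf pq.1) s1.
- by rewrite -[surf _]/(surf pq.2) s2.
- by rewrite -(mulgA z (pq.2 _)) zxz ?groupM ?groupV // mulgKV mulgV.
- by rewrite zxz // mulgV.
- rewrite (zz Zz nz) mul1g -(mulgA (pq.2 _) z) -(mulgA (pq.2 _) (z * _) z).
  by rewrite zxz ?groupV // mulgKV mulgV.
Qed.

Lemma epi_of_gen pq : pq \in adm_pairs G ->
  gen_values (epi_of pq) = assign pq.
Proof.
move=> Tpq; apply: funext => g; rewrite /gen_values /=.
exact: (pres_lift_pi (assign_rel Tpq) (GGen g)).
Qed.

Lemma epi_of_adm pq : pq \in adm_pairs G -> admissible_epi G (epi_of pq).
Proof.
move=> Tpq; have [pG qG pq12 s1 s2] := adm_pairP _ Tpq.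
have phiM := pres_lift_morph (assign_rel Tpq).
have fG g := assign_in g pG qG.
split=> //.
- apply/seteqP; split=> [_ [w _ <-]|g Gg]; first exact: eval_closed.
  (* the range is a subgroup, so it contains the normal forms in strand 1 *)
  pose H := [set x | `[< exists w, epi_of pq w = x >] ]%SET.
  have gH : group_set H.
    apply/group_setP; split=> [|x y]; rewrite !finset.inE.
      apply/asboolP; exists (presented_one _).
      by rewrite /epi_of pres_lift_pi //; apply: assign_rel.
    move=> /asboolP[w <-] /asboolP[w' <-]; apply/asboolP; exists (w * w').
    exact: phiM.
  have genH k : assign pq k \in H.
    rewrite finset.inE -(epi_of_gen Tpq); apply/asboolP.
    by exists (presented_gen _ k).
  have d12 : dual pq.1 pq.2 by apply/dualE.
  have [w ew] := word_onto d12 (zcent Zz qG) nz pG (zG Zz) (card_rank4 oG) Gg.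
  have : g \in Group gH.
    rewrite ew; apply: word_closed => [[j []]|]; first exact: (genH (gen_tau1 j)).
      exact: (genH (gen_rho1 j)).
    exact: (genH gen_A12).
  by rewrite finset.inE => /asboolP[w' <-]; exists w'.
- have := congr1 (@^~ gen_A12) (epi_of_gen Tpq); rewrite /gen_values /= => ->.
  exact/eqP.
Qed.

(** The inverse of [A12] is the commutator of [rho_11] and [tau_21], hence lies
    in the derived subgroup, which is the centre. *)
Lemma adm_A_central phi : admissible_epi G phi -> gen_values phi gen_A12 = z.
Proof.
move=> phiA; have GA := adm_in phiA.
have := braid_rho_tau (adm_rel phiA) j0; rewrite (gcg_om esG Zz) //.
case: (om _ _) => /= e; last first.
  by have := adm_A phiA; rewrite -eq_invg1 -e eqxx.
by apply: invg_inj; rewrite -e expg1 zV.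
Qed.

Definition pair_of phi : pair :=
  ([ffun i => strand1 (gen_values phi) i], [ffun i => strand2 (gen_values phi) i]).

Lemma epi_pair_of phi : admissible_epi G phi -> epi_of (pair_of phi) = phi.
Proof.
move=> phiA; have [phiM _ _] := phiA; rewrite [RHS](morph_pres_lift phiM).
congr pres_lift; apply: funext => -[j|j|j|j|] /=; rewrite ?ffunE //.
by rewrite -(adm_A_central phiA).
Qed.

Lemma pair_of_adm phi : admissible_epi G phi -> pair_of phi \in adm_pairs G.
Proof.
move=> phiA; have fR := adm_rel phiA; have fG := adm_in phiA.
have fA := adm_A_central phiA.
have ZA : gen_values phi gen_A12 \in 'Z(G) by rewrite fA (zZ Zz).
have surf_ffun (x : I2 -> gT) : surf [ffun i => x i] = surf x.
  by rewrite /surf !ffunE.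
apply/adm_pairP; split=> [i|i|i j||] /=.
- by rewrite ffunE adm_strand1_in.
- by rewrite ffunE adm_strand2_in.
- by rewrite !ffunE; apply: ((dualE _ _).1 (adm_dual phiA ZA)).
- rewrite surf_ffun; have := fR _ _ (surface1 2); rewrite eval_surface1 //= fA.
  by rewrite -{2}[z]expg1 => /(@zX_inj _ _ nz _ true).
- rewrite surf_ffun; have := fR _ _ (surface2 2); rewrite eval_surface2 //= fA zV.
  by rewrite -{2}[z]expg1 => /(@zX_inj _ _ nz _ true).
Qed.

Lemma epi_of_inj : {in adm_pairs G &, injective epi_of}.
Proof.
move=> pq pq' Tpq Tpq' e.
have : assign pq = assign pq' by rewrite -!epi_of_gen // e.
case: pq pq' {Tpq Tpq' e} => [p q] [p' q'] e.
congr (_, _); apply/ffunP=> -[j []].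
- exact: (congr1 (@^~ (gen_tau1 j)) e).
- exact: (congr1 (@^~ (gen_rho1 j)) e).
- exact: (congr1 (@^~ (gen_rho2 j)) e).
- exact: (congr1 (@^~ (gen_tau2 j)) e).
Qed.

Lemma adm_epi_image :
  (admissible_epi G : set (P2 2 -> gT)) =
  [set epi_of pq | pq in [set` adm_pairs G]]%classic.
Proof.
apply/seteqP; split=> [phi phiA|_ [pq Tpq <-]]; last exact: epi_of_adm.
by exists (pair_of phi); [apply: pair_of_adm | apply: epi_pair_of].
Qed.

End GenusTwo.

(** * Orbits of automorphisms *)

Lemma card_finset (T : finType) (A : {set T}) : [set` A]%classic #= `I_#|A|.
Proof.
have -> : [set` A]%classic = [set (enum_val i : T) | i in [set: 'I_#|A|]]%classic.
  apply/seteqP; split=> [x /= Ax|_ [i _ <-]]; last exact: enum_valP.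
  by exists (enum_rank_in Ax x) => //; rewrite enum_rankK_in.
apply: (card_eq_trans _ (card_esym card_II)).
apply: inj_card_eq => i j _ _; exact: enum_val_inj.
Qed.

Section Orbits.
Variables (gT : finGroupType) (G : {group gT}) (z : gT).
Hypotheses (esG : extraspecial G) (Zz : 'Z(G) = [set 1; z]%SET) (nz : z != 1).
Hypothesis oG : #|G| = 32%N.
Local Notation pair := ({ffun I2 -> gT} * {ffun I2 -> gT})%type.

Definition pair_act (pq : pair) (a : {perm gT}) : pair :=
  ([ffun i => a (pq.1 i)], [ffun i => a (pq.2 i)]).

Lemma pair_act1 : pair_act^~ 1 =1 id.
Proof. by case=> p q; congr (_, _); apply/ffunP=> i; rewrite ffunE perm1. Qed.

Lemma pair_actM pq : act_morph pair_act pq.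
Proof.
by move=> a b; congr (_, _); apply/ffunP=> i; rewrite !ffunE /= permM.
Qed.

Canonical pair_action := TotalAction pair_act1 pair_actM.

Lemma adm_pairs_acts : [acts Aut G, on adm_pairs G | pair_action].
Proof.
apply/fintype.subsetP => a Aa; rewrite !finset.inE /=; apply/fintype.subsetP => pq.
case/adm_pairP=> pG qG pq12 s1 s2; rewrite finset.inE; apply/adm_pairP.
have surf_a (x : I2 -> gT) : (forall i, x i \in G) ->
    surf [ffun i => a (x i)] = surf x.
  by move=> xG; rewrite /surf !ffunE !(aut_om Aa).
split=> [i|i|i j||] /=; rewrite ?surf_a ?ffunE ?Aut_closed //.
by rewrite (aut_om Aa).
Qed.

(** Automorphisms act freely, a first strand being a generating family. *)
Lemma pair_act_free pq a : pq \in adm_pairs G -> a \in Aut G ->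
  pair_act pq a = pq -> a = 1.
Proof.
case/adm_pairP=> pG qG pq12 _ _ Aa /(congr1 fst) /= e.
apply: (eq_Aut Aa (group1 _)) => g Gg; rewrite perm1.
have d12 : dual pq.1 pq.2 by apply/dualE.
have [w ->] := word_onto d12 (zcent Zz qG) nz pG (zG Zz) (card_rank4 oG) Gg.
rewrite (aut_word Zz nz w Aa pG); congr (_ * _); apply: eq_bigr => i _.
by congr (_ ^+ _) => /=; rewrite -{2}e ffunE.
Qed.

Lemma card_adm_orbits :
  (#|[set orbit pair_action (Aut G) pq | pq in adm_pairs G]%SET| * #|Aut G|
     = #|adm_pairs G|)%N.
Proof.
rewrite -(acts_sum_card_orbit adm_pairs_acts) -sum_nat_const.
apply: eq_bigr => _ /imsetP[pq Tpq ->].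
rewrite card_orbit; suff -> : 'C_(Aut G)[pq | pair_action] = 1 by rewrite indexg1.
apply/trivgP/fintype.subsetP => a /finset.setIP[Aa /astab1P e].
by apply/set1P; apply: pair_act_free e.
Qed.

Lemma Aut_orbit_epi pq : pq \in adm_pairs G ->
  Aut_orbit G (epi_of z pq) =
  [set epi_of z x | x in [set` orbit pair_action (Aut G) pq]]%classic.
Proof.
move=> Tpq.
have epi_a a : a \in Aut G -> a \o epi_of z pq = epi_of z (pair_act pq a).
  move=> Aa; have [pG qG _ _ _] := adm_pairP _ _ Tpq.
  apply: funext => w; rewrite /epi_of /pres_lift /=.
  elim: (generic_quotient.repr w) => [|g|e IHe|e1 IH1 e2 IH2] /=.
  - exact: aut1 Aa.
  - by case: g => [j|j|j|j|] /=; rewrite ?ffunE // (aut_z Zz nz).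
  - rewrite -IHe -(autmE Aa) morphV //.
    by apply: eval_closed => g; apply: (assign_in Zz).
  - rewrite -IH1 -IH2 (autM Aa) //;
    by apply: eval_closed => g; apply: (assign_in Zz).
apply/seteqP; split=> [_ [a Aa <-]|_ [x /= /orbitP[a Aa <-] <-]].
  by exists (pair_act pq a); [apply/orbitP; exists a|rewrite epi_a].
by exists a => //; rewrite epi_a.
Qed.

Lemma card_Aut_orbits : Aut_orbits 2 G #=
  `I_#|[set orbit pair_action (Aut G) pq | pq in adm_pairs G]%SET|.
Proof.
set O := [set _ | _ in _]%SET.
pose F (S : {set pair}) := [set epi_of z x | x in [set` S]]%classic.
have -> : Aut_orbits 2 G = [set F S | S in [set` O]]%classic.
  rewrite /Aut_orbits (adm_epi_image esG Zz nz oG).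
  apply/seteqP; split=> [_ [_ [pq Tpq <-] <-]|_ [_ /= /imsetP[pq Tpq ->] <-]].
    exists (orbit pair_action (Aut G) pq); last exact/esym/Aut_orbit_epi.
    by apply/imsetP; exists pq.
  by exists (epi_of z pq); [exists pq | apply: Aut_orbit_epi].
apply: (card_eq_trans _ (card_finset O)); apply: inj_card_eq.
have sub S : S \in O -> S \subset adm_pairs G.
  by case/imsetP=> pq Tpq ->; rewrite acts_sub_orbit // adm_pairs_acts.
have half S S' : S \in O -> S' \in O -> F S = F S' -> S \subset S'.
  move=> OS OS' e; apply/fintype.subsetP => x Sx.
  have : F S (epi_of z x) by exists x.
  rewrite e => -[x' /= S'x' e'].
  rewrite -(epi_of_inj esG Zz nz _ _ e') //.
    exact: (fintype.subsetP (sub _ OS')).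
  exact: (fintype.subsetP (sub _ OS)).
move=> S S' OS OS' e; have {}OS : S \in O by rewrite inE in OS.
have {}OS' : S' \in O by rewrite inE in OS'.
by apply/eqP; rewrite finset.eqEsubset !half.
Qed.

Lemma card_admissible : (admissible_epi G : set (P2 2 -> gT)) #= `I_#|adm_pairs G|.
Proof.
rewrite (adm_epi_image esG Zz nz oG).
apply: (card_eq_trans _ (card_finset _)); apply: inj_card_eq.
move=> pq pq'; rewrite !inE; exact: (epi_of_inj esG Zz nz).
Qed.

End Orbits.

(** * Symplectic bases *)

(** [G] is a central product of two non-abelian groups of order 8, in each of
    which there are two elements that do not commute. *)
Lemma extraspecial32_symplectic (gT : finGroupType) (G : {group gT}) :
  extraspecial G -> #|G| = 32%N ->
  exists z p, [/\ 'Z(G) = [set 1; z]%SET, z != 1 & symplectic G p].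
Proof.
move=> esG oG; have pG : 2.-group G by rewrite /pgroup oG.
have oZ : #|'Z(G)| = 2%N.
  have [_ prZ] := esG; have := cardSg (center_sub G); rewrite oG.
  by rewrite -[32%N]/(2 ^ 5)%N Euclid_dvdX // dvdn_prime2 // => /andP[/eqP].
have [x Gx nZx] : exists2 x, x \in G & x \notin 'Z(G).
  by apply/fintype.subsetPn/negP=> /subset_leq_card; rewrite oG oZ.
have xGZ : x \in G :\: 'Z(G) by rewrite finset.inE nZx.
have [E [R [[_ oR] [defG _] [_ eZR] [esE _] abR]]] := split1_extraspecial pG esG xGZ.
have [_ eG cER] := cprodP defG.
have nabR : ~~ abelian R.
  by apply/negP=> ab; rewrite ab in abR; rewrite abR oZ oG in oR.
have nabE : ~~ abelian E.
  apply/negP=> /derG1P E1; have [[_ eE] pE] := esE.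
  by move: pE; rewrite -eE E1 cards1.
have noncomm (H : {group gT}) : ~~ abelian H ->
    exists a b, [/\ a \in H, b \in H & om a b].
  case/fintype.subsetPn => a Ha /centP nc.
  have [b Hb nb] : exists2 b, b \in H & a \notin 'C[b].
    apply: contrapT => h; apply: nc => b Hb; apply/cent1P; apply: contrapT => nb.
    by apply: h; exists b => //; apply/negP.
  by exists a, b.
have [r1 [t1 [Er1 Et1 o1]]] := noncomm _ nabE.
have [r2 [t2 [Rr2 Rt2 o2]]] := noncomm _ nabR.
have [sEG sRG] : E \subset G /\ R \subset G by rewrite -eG mulG_subl mulG_subr.
have c12 a b : a \in E -> b \in R -> om a b = false.
  by move=> Ea Rb; apply/negbTE; rewrite negbK; apply/cent1P/commute_sym/(centsP cER).
have [z Zz1] : exists z, 'Z(G) :\ 1 = [set z]%SET.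
  apply/cards1P; have := cardsD1 1 'Z(G); rewrite oZ group1.
  by move=> /eqP; rewrite eqSS eq_sym.
have nz : z != 1.
  have : z \in [set z]%SET by rewrite finset.inE.
  by rewrite -Zz1 finset.inE => /andP[/set1P/eqP].
exists z, (ffun_of_quad (r1, t1, r2, t2)); split=> //.
  by have := finset.setD1K (group1 'Z(G)); rewrite Zz1 => <-.
split=> [i|i k].
  by elim/I2_ind: i; rewrite ffunE /=;
    [apply: (fintype.subsetP sEG) | apply: (fintype.subsetP sEG)
    |apply: (fintype.subsetP sRG) | apply: (fintype.subsetP sRG)].
by elim/I2_ind: i; elim/I2_ind: k; rewrite !ffunE /= ?omxx //;
  first [by rewrite c12 | by rewrite omC c12 | by rewrite omC].
Qed.

(** * Satisfying a presentation *)

Section Satisfying.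
Variable gT : finGroupType.
Import Presentation.

(** The relations of a presentation are tested by a single boolean equality
    between nested tuples; [holds] and [satisfies] are the same conditions as
    propositions, one for each relation. *)
Fixpoint holds (e : seq gT) (f : formula) : Prop :=
  match f with
  | Eq2 s t => Presentation.eval e s = Presentation.eval e t
  | And f1 f2 => holds e f1 /\ holds e f2
  end.

Fixpoint satisfies (vT : finType) (B : {set gT}) (n : nat) (s : vT -> env gT)
    (p : Presentation.type) : Prop :=
  match p with
  | Formula f => exists v, let: Env A e := s v in A = B /\ holds (rev e) f
  | Generator p' =>
    satisfies B n.+1
      (fun v : vT * gT => let: Env A e := s v.1 in
         Env (A <*> <[v.2]>) (v.2 :: e)) (p' (Cst n))
  end.

Lemma and_relE (vT : finType) (x y : vT) r :
  and_rel x y r = (x == y) && r :> bool.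
Proof. by case: r => //=; rewrite andbT. Qed.

Lemma relP (e : seq gT) (f : formula) (r : rel_type) :
  rel e f r <-> holds e f /\ r.
Proof.
elim: f r => [s t|f1 IH1 f2 IH2] r /=.
  by rewrite and_relE; split=> [/andP[/eqP]|[-> ->]]; rewrite ?eqxx.
by rewrite IH1 IH2; tauto.
Qed.

Lemma sat_satisfies p (vT : finType) (B : {set gT}) n (s : vT -> env gT) :
  sat B n s p <-> satisfies B n s p.
Proof.
elim: p vT n s => [p' IHp|f] vT n s /=; first exact: IHp.
split=> [/existsP[v h]|[v h]]; [|apply/existsP]; exists v;
  case: (s v) h => A e; rewrite and_relE.
  by case/andP=> /eqP-> /relP[].
by case=> -> h; rewrite eqxx; apply/relP.
Qed.

Lemma homg_satisfies (G : {set gT}) p :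
  hom G p <-> satisfies G 1 (env1 (gT := gT)) (p (Cst 0)).
Proof. exact: sat_satisfies. Qed.

End Satisfying.

(** * The groups with the two presentations *)

Section Relations.
Variables (gT : finGroupType) (G : {group gT}) (z : gT) (p : I2 -> gT).
Hypotheses (pG : forall i, p i \in G) (zG : z \in G) (nz : z != 1).
Hypothesis genG :
  forall H : {group gT}, (forall i, p i \in H) -> z \in H -> G \subset H.
Hypotheses (z2 : z * z = 1) (zp : forall i, commute (p i) z).
Hypothesis pp : forall i k, gcg (p i) (p k) = z ^+ (k == flip i).
Hypothesis psq : forall i, p i * p i = 1 \/ p i * p i = z.

Lemma relations_center : z \in 'Z(G).
Proof.
rewrite finset.inE zG -sub_cent1; apply: genG => [i|]; last exact: cent1id.
exact/cent1P.
Qed.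

Lemma relations_symplectic : symplectic G p.
Proof.
split=> // i k; apply: negb_inj; rewrite negbK.
have nzb : (z ^+ (k == flip i) == 1) = (k != flip i).
  by case: (k == flip i); rewrite ?expg1 ?(negbTE nz) // expg0 eqxx.
rewrite -nzb -pp; apply/cent1P/eqP => h; first exact/gcg_eq1.
exact/gcg_eq1.
Qed.

(** Modulo [z] the four generators commute and have order at most 2. *)
Lemma relations_card_le : (#|G| <= 32)%N.
Proof.
pose N := <[z]>%G.
have oN : #|N| = 2%N.
  apply/prime_nt_dvdP => //; first by rewrite -trivg_card1 cycle_eq1.
  by rewrite [#|N|]/#[z] order_dvdn (expgS _ 1) expg1 z2.
have sNZ : N \subset 'Z(G) by rewrite cycle_subG relations_center.
have nNG : N <| G by apply: sub_center_normal.
have nN g : g \in G -> g \in 'N(N) by apply/fintype.subsetP/normal_norm.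
have Nz : z \in N := cycle_id z.
pose B := [set coset N (p i) | i : I2]%SET.
have sQ : G / N \subset <<B>>.
  rewrite quotientE sub_morphim_pre ?normal_norm //; apply: genG => [i|].
    by apply/morphpreP; split; [apply: nN | apply/mem_gen/imsetP; exists i].
  by apply/morphpreP; split; [apply: nN | rewrite /= coset_id // group1].
have abB : abelian <<B>>.
  rewrite abelian_gen; apply/centsP=> _ /imsetP[i _ ->] _ /imsetP[k _ ->].
  have [nNi nNk] := (nN _ (pG i), nN _ (pG k)).
  apply/gcg_eq1; rewrite -!morphV // -!morphM ?groupM ?groupV //.
  by rewrite /= pp coset_id ?groupX.
have abemB : 2.-abelem <<B>>.
  rewrite abelemE // abB /=; apply/exponentP.
  pose K := [set x in <<B>> | x * x == 1]%SET.
  have gK : group_set K.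
    apply/group_setP; rewrite finset.inE group1 mulg1 eqxx; split=> // x y.
    rewrite !finset.inE => /andP[Bx /eqP x2] /andP[By /eqP y2].
    rewrite groupM // -mulgA (mulgA y x y) (centsP abB y By x Bx) -(mulgA x y y).
    by rewrite y2 mulg1 x2 eqxx.
  have sBK : <<B>> \subset Group gK.
    rewrite gen_subG; apply/fintype.subsetP=> y By; rewrite finset.inE mem_gen //=.
    have /imsetP[i _ ->] := By; rewrite -morphM ?nN //=.
    by rewrite coset_id //; case: (psq i) => ->.
  move=> x /(fintype.subsetP sBK); rewrite finset.inE => /andP[_ /eqP x2].
  by rewrite (expgS _ 1) expg1.
have pB : 2.-group <<B>> := abelem_pgroup abemB.
have B16 : (#|<<B>>| <= 16)%N.
  have := grank_min B; rewrite (grank_abelian abB) (rank_pgroup pB) p_rank_abelem //.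
  have [n ->] := p_natP pB; rewrite pfactorK // => nB.
  rewrite -[16%N]/(2 ^ 4)%N leq_pexp2l // (leq_trans nB) //.
  have <- : #|{: I2}| = 4%N by rewrite card_prod card_ord card_bool.
  exact: leq_imset_card.
rewrite -(Lagrange (normal_sub nNG)) oN -card_quotient ?normal_norm //.
by rewrite -[32%N]/(2 * 16)%N leq_mul2l /= (leq_trans (subset_leq_card sQ)).
Qed.

Lemma relations_card : #|G| = 32%N.
Proof.
apply/eqP; rewrite eqn_leq relations_card_le /=.
have cz i : z \in 'C[(p \o flip) i] by apply/cent1P/commute_sym/zp.
have := dual_card_ge (symplectic_dual relations_symplectic) cz nz pG zG.
by rewrite card_prod card_ord card_bool.
Qed.

Lemma relations_centerE : 'Z(G) = [set 1; z]%SET.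
Proof.
apply: (dual_center (symplectic_dual relations_symplectic)) => //.
- by move=> i; apply: pG.
- exact: relations_center.
- by rewrite relations_card card_prod card_ord card_bool.
Qed.

(** The generators commute modulo [z], which spans the centre. *)
Lemma relations_extraspecial : extraspecial G.
Proof.
have oZ : #|'Z(G)| = 2%N by rewrite relations_centerE cards2 eq_sym nz.
apply: extraspecial_card2; rewrite ?/pgroup ?relations_card //.
have nN g : g \in G -> g \in 'N('Z(G)).
  exact/fintype.subsetP/normal_norm/center_normal.
have Zz := relations_center.
have cZ (x : coset_of 'Z(G)) : (forall i, coset 'Z(G) (p i) \in 'C[x]) ->
    G / 'Z(G) \subset 'C[x].
  move=> cx; rewrite quotientE sub_morphim_pre ?gFnorm //; apply: genG => [i|].
    by apply/morphpreP; split; [apply: nN | apply: cx].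
  by apply/morphpreP; split; [apply: nN | rewrite /= (coset_id Zz) group1].
have c1 i k : coset 'Z(G) (p k) \in 'C[coset 'Z(G) (p i)].
  apply/cent1P/gcg_eq1; rewrite -!morphV ?nN // -!morphM ?nN ?groupM ?groupV //.
  by rewrite /= pp coset_id ?groupX.
have c2 i : coset 'Z(G) (p i) \in 'C(G / 'Z(G)).
  by rewrite -sub_cent1; apply: cZ.
apply/centsP=> x Qx y Qy; apply/cent1P.
apply: (fintype.subsetP (cZ y _)) => // i.
by apply/cent1P; have /centP := c2 i; apply.
Qed.
End Relations.

(** Were [z] trivial, [G] would be abelian, and so would its image [H]. *)
Lemma homg_nonabelian (gT hT : finGroupType) (G : {group gT}) (H : {group hT})
    (z : gT) (p : I2 -> gT) :
    H \homg G -> ~~ abelian H ->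
    (forall K : {group gT}, (forall i, p i \in K) -> z \in K -> G \subset K) ->
    (forall i k, gcg (p i) (p k) = z ^+ (k == flip i)) ->
  z != 1.
Proof.
case/homgP=> f <- nab gen pp; apply: contra nab => /eqP z1.
rewrite morphim_abelian //.
have cp i k : p k \in 'C[p i].
  by apply/cent1P/gcg_eq1; rewrite pp z1 expg1n.
have c1 i : p i \in 'C(G).
  by rewrite -sub_cent1; apply: gen => [k|]; rewrite ?cp // z1 group1.
by apply: gen => [//|]; rewrite z1 group1.
Qed.

Lemma gcg_eq (gT : groupType) (x y w : gT) :
  w * (x * y) = y * x <-> gcg x y = w^-1.
Proof.
split=> [e|e]; first apply: (mulgI w).
  by rewrite mulgV !mulgA -(mulgA w x y) e mulgK mulgV.
by apply: (mulgI w^-1); rewrite mulKg -e mulgA !mulgKV.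
Qed.

(** The relations common to the two groups, with [e] the exponent of [z] in the
    squares of [r2] and [t2]. *)
Definition rank4_relations (hT : finGroupType) (r1 t1 r2 t2 z : hT)
    (e : bool) : Prop :=
  [/\ r1 * r1 = 1, t1 * t1 = 1, r2 * r2 = z ^+ e, t2 * t2 = z ^+ e & z * z = 1]
  /\ [/\ commute r1 z, commute t1 z, commute r2 z & commute t2 z]
  /\ [/\ commute r1 r2, commute t1 t2, commute r1 t2 & commute r2 t1]
  /\ z * (r1 * t1) = t1 * r1 /\ z * (r2 * t2) = t2 * r2.

(** The group [H] serves to show that the relations do not force [z] to be
    trivial. *)
Lemma presented_extraspecial (gT hT : finGroupType) (G : {group gT})
    (H : {group hT}) (r1 t1 r2 t2 z : gT) (e : bool) :
    H \homg G -> ~~ abelian H ->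
    <[r1]> <*> <[t1]> <*> <[r2]> <*> <[t2]> <*> <[z]> = G ->
    rank4_relations r1 t1 r2 t2 z e ->
  exists p, [/\ extraspecial G, #|G| = 32%N, 'Z(G) = [set 1; z]%SET,
    z != 1 & symplectic G p
    /\ quad_of_ffun [ffun i => sq (p i)] = (false, false, e, e)].
Proof.
move=> HG nab defG [[r1r1 t1t1 r2r2 t2t2 zz] [[r1z t1z r2z t2z]]].
move=> [[r1r2 t1t2 r1t2 r2t1] [/gcg_eq rt1 /gcg_eq rt2]].
pose p : I2 -> gT := ffun_of_quad (r1, t1, r2, t2).
have pE : (p (j0, false) = r1) * (p (j0, true) = t1)
        * (p (j1, false) = r2) * (p (j1, true) = t2) by rewrite /p !ffunE.
have zV : z^-1 = z by apply: (mulgI z); rewrite mulgV zz.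
have gcgC x y : gcg x y = z^-1 -> gcg y x = z.
  by move=> h; rewrite -[RHS]invgK -h !invMg !invgK !mulgA.
have gen (K : {group gT}) : (forall i, p i \in K) -> z \in K -> G \subset K.
  move=> pK zK; rewrite -defG !join_subG !cycle_subG zK !andbT.
  have := pK (j0, false); have := pK (j0, true); have := pK (j1, false).
  by have := pK (j1, true); rewrite !pE => -> -> -> ->.
have pp i k : gcg (p i) (p k) = z ^+ (k == flip i).
  by elim/I2_ind: i; elim/I2_ind: k; rewrite !pE /= ?expg1 ?expg0;
    first [apply/gcg_eq1; first [by [] | exact: commute_sym]
      | by rewrite ?rt1 ?rt2 | exact: gcgC].
have nz := homg_nonabelian HG nab gen pp.
have [pG zG] : (forall i, p i \in G) /\ z \in G.
  have : G \subset G by []. rewrite -{1}defG !join_subG !cycle_subG.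
  move=> /andP[/andP[/andP[/andP[h1 h2] h3] h4] h5]; split=> //.
  by elim/I2_ind; rewrite pE.
have zp i : commute (p i) z by elim/I2_ind: i; rewrite pE.
have psq i : p i * p i = 1 \/ p i * p i = z.
  by elim/I2_ind: i; rewrite !pE ?r1r1 ?t1t1 ?r2r2 ?t2t2;
    case: (e); rewrite ?expg1; auto.
exists p; split=> //.
- exact: (relations_extraspecial pG zG nz gen zz zp pp psq).
- exact: (relations_card pG zG nz gen zz zp pp psq).
- exact: (relations_centerE pG zG nz gen zz zp pp psq).
split; first exact: (relations_symplectic pG nz pp).
have sqz x (b : bool) : x * x = z ^+ b -> sq x = b.
  move=> h; rewrite /sq (expgS _ 1) expg1 h.
  by case: b {h}; rewrite ?expg1 ?nz // expg0 eqxx.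
rewrite /quad_of_ffun !ffunE /= !pE (sqz _ _ r2r2) (sqz _ _ t2t2).
by rewrite (sqz r1 false) // (sqz t1 false).
Qed.

(** ** Permutation models of the two presentations *)

(** Signed permutations of a space of functions on bits, the last coordinate
    being the sign: [r1] flips a bit, and [t1] changes the sign where that bit
    is set. *)
Lemma H5_model : exists r1 t1 r2 t2 z : {perm bool * bool * bool},
  rank4_relations r1 t1 r2 t2 z false /\ ~ commute r1 t1.
Proof.
pose r1 (x : bool * bool * bool) := let: (a, b, s) := x in (~~ a, b, s).
pose t1 (x : bool * bool * bool) := let: (a, b, s) := x in (a, b, a (+) s).
pose r2 (x : bool * bool * bool) := let: (a, b, s) := x in (a, ~~ b, s).
pose t2 (x : bool * bool * bool) := let: (a, b, s) := x in (a, b, b (+) s).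
pose z (x : bool * bool * bool) := let: (a, b, s) := x in (a, b, ~~ s).
have ir1 : injective r1 by move=> [[[] []] []] [[[] []] []].
have it1 : injective t1 by move=> [[[] []] []] [[[] []] []].
have ir2 : injective r2 by move=> [[[] []] []] [[[] []] []].
have it2 : injective t2 by move=> [[[] []] []] [[[] []] []].
have iz : injective z by move=> [[[] []] []] [[[] []] []].
exists (perm ir1), (perm it1), (perm ir2), (perm it2), (perm iz); split.
  rewrite /rank4_relations expg0; do ?split; apply/permP => -[[a b] s];
    rewrite ?permM ?permE ?perm1 /=; by case: a b s => [] [] [].
move/(congr1 (fun f : {perm _} => f (false, false, false))).
by rewrite !permM !permE.
Qed.

(** The quaternion group generated by [r2] and [t2] needs a third bit, on which
    [t2] has square -1; [t2] also changes the sign where the second bit is set,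
    so as to anticommute with [r2]. *)
Lemma G5_model : exists r1 t1 r2 t2 z : {perm bool * bool * bool * bool},
  rank4_relations r1 t1 r2 t2 z true /\ ~ commute r1 t1.
Proof.
pose T := (bool * bool * bool * bool)%type.
pose r1 (x : T) : T := let: (a, b, c, s) := x in (~~ a, b, c, s).
pose t1 (x : T) : T := let: (a, b, c, s) := x in (a, b, c, a (+) s).
pose r2 (x : T) : T := let: (a, b, c, s) := x in (a, ~~ b, c, b (+) s).
pose t2 (x : T) : T := let: (a, b, c, s) := x in (a, b, ~~ c, b (+) c (+) s).
pose z (x : T) : T := let: (a, b, c, s) := x in (a, b, c, ~~ s).
have ir1 : injective r1 by move=> [[[[] []] []] []] [[[[] []] []] []].
have it1 : injective t1 by move=> [[[[] []] []] []] [[[[] []] []] []].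
have ir2 : injective r2 by move=> [[[[] []] []] []] [[[[] []] []] []].
have it2 : injective t2 by move=> [[[[] []] []] []] [[[[] []] []] []].
have iz : injective z by move=> [[[[] []] []] []] [[[[] []] []] []].
exists (perm ir1), (perm it1), (perm ir2), (perm it2), (perm iz); split.
  rewrite /rank4_relations [_ ^+ true]expg1; do ?split;
    apply/permP => -[[[a b] c] s];
    rewrite ?permM ?permE ?perm1 /=; by case: a b c s => [] [] [] [].
move/(congr1 (fun f : {perm _} => f (false, false, false, false))).
by rewrite !permM !permE.
Qed.

Lemma H5_homg (gT hT : finGroupType) (G : {group gT}) (r1 t1 r2 t2 z : hT) :
    is_H5 G -> rank4_relations r1 t1 r2 t2 z false ->
  (<[r1]> <*> <[t1]> <*> <[r2]> <*> <[t2]> <*> <[z]>)%G \homg G.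
Proof.
move=> isoG [[r1r1 t1t1 r2r2 t2t2 zz] [[r1z t1z r2z t2z]]].
move=> [[r1r2 t1t2 r1t2 r2t1] [/gcg_eq rt1 /gcg_eq rt2]].
rewrite isoG; apply/homg_satisfies; exists (r1, t1, r2, t2, z) => /=.
by split=> //; do ?split; rewrite ?(expgS _ 1) ?expg1 //; apply/gcg_eq1.
Qed.

Lemma G5_homg (gT hT : finGroupType) (G : {group gT}) (r1 t1 r2 t2 z : hT) :
    is_G5 G -> rank4_relations r1 t1 r2 t2 z true ->
  (<[r1]> <*> <[t1]> <*> <[r2]> <*> <[t2]> <*> <[z]>)%G \homg G.
Proof.
move=> isoG [[r1r1 t1t1 r2r2 t2t2 zz] [[r1z t1z r2z t2z]]].
move=> [[r1r2 t1t2 r1t2 r2t1] [/gcg_eq rt1 /gcg_eq rt2]].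
rewrite isoG; apply/homg_satisfies; exists (r1, t1, r2, t2, z) => /=.
by split=> //; do ?split; rewrite ?(expgS _ 1) ?expg1 //; apply/gcg_eq1.
Qed.

Lemma noncommuting_generators (hT : finGroupType) (r1 t1 r2 t2 z : hT) :
  ~ commute r1 t1 ->
  ~~ abelian (<[r1]> <*> <[t1]> <*> <[r2]> <*> <[t2]> <*> <[z]>).
Proof.
move=> nrt; set H := _ <*> <[z]>; apply/negP=> /centsP ab; apply: nrt.
have : H \subset H by []; rewrite {1}/H !join_subG !cycle_subG.
by move=> /andP[/andP[/andP[/andP[Hr Ht] _] _] _]; apply: ab.
Qed.

Lemma is_H5_symplectic (gT : finGroupType) (G : {group gT}) : is_H5 G ->
  exists z p, [/\ extraspecial G, #|G| = 32%N, 'Z(G) = [set 1; z]%SET,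
    z != 1 & symplectic G p
    /\ quad_of_ffun [ffun i => sq (p i)] = (false, false, false, false)].
Proof.
move=> isoG; have [r1 [t1 [r2 [t2 [z [rel nrt]]]]]] := H5_model.
have /homg_satisfies[[[[[R1 T1] R2] T2] Z] /= [defG rels]] := isoGrp_hom isoG.
move: rels; rewrite !(expgS _ 1) !expg1.
case=> [r1r1 [t1t1 [r2r2 [t2t2 [zz [/gcg_eq1 r1z [/gcg_eq1 t1z [/gcg_eq1 r2z
  [/gcg_eq1 t2z [/gcg_eq1 r1r2 [/gcg_eq1 t1t2 [rt1 [rt2 [/gcg_eq1 r1t2
  /gcg_eq1 r2t1]]]]]]]]]]]]]].
exists Z; apply: (presented_extraspecial (e := false) (H5_homg isoG rel)
  (noncommuting_generators r2 t2 z nrt) defG).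
by do 4?split=> //; apply/gcg_eq.
Qed.

Lemma is_G5_symplectic (gT : finGroupType) (G : {group gT}) : is_G5 G ->
  exists z p, [/\ extraspecial G, #|G| = 32%N, 'Z(G) = [set 1; z]%SET,
    z != 1 & symplectic G p
    /\ quad_of_ffun [ffun i => sq (p i)] = (false, false, true, true)].
Proof.
move=> isoG; have [r1 [t1 [r2 [t2 [z [rel nrt]]]]]] := G5_model.
have /homg_satisfies[[[[[R1 T1] R2] T2] Z] /= [defG rels]] := isoGrp_hom isoG.
move: rels; rewrite !(expgS _ 1) !expg1.
case=> [r1r1 [t1t1 [zz [r2r2 [t2t2 [/gcg_eq1 r1z [/gcg_eq1 t1z [/gcg_eq1 r2z
  [/gcg_eq1 t2z [/gcg_eq1 r1r2 [/gcg_eq1 t1t2 [rt1 [rt2 [/gcg_eq1 r1t2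
  /gcg_eq1 r2t1]]]]]]]]]]]]]].
exists Z; apply: (presented_extraspecial (e := true) (G5_homg isoG rel)
  (noncommuting_generators r2 t2 z nrt) defG).
by do 4?split=> //; apply/gcg_eq.
Qed.

(** * Counting epimorphisms and orbits *)

Section Counts.
Variables (gT : finGroupType) (G : {group gT}) (z : gT) (p : I2 -> gT).
Hypotheses (esG : extraspecial G) (Zz : 'Z(G) = [set 1; z]%SET) (nz : z != 1).
Hypotheses (oG : #|G| = 32%N) (sp : symplectic G p).

Lemma card_adm_pairs32 : #|adm_pairs G| = (1152 * 1920)%N.
Proof.
rewrite (card_adm_pairs esG Zz nz oG) (card_adm_first esG Zz nz oG sp).
lia.
Qed.

(** The action being free, all orbits have as many elements as [Aut G], namely
    16 for each of the [m] isometries of the quadratic form. *)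
Lemma card_Aut_orbits32 (e : bool * bool * bool * bool) (m n : nat) :
    quad_of_ffun [ffun i => sq (p i)] = e ->
    count (basis_test e) (quads bool_quads) = m -> (0 < m)%N ->
    (n * (m * 16) = 1152 * 1920)%N ->
  Aut_orbits 2 G #= `I_n.
Proof.
move=> pe em m0 en; have := card_Aut_orbits esG Zz nz oG.
have := card_adm_orbits Zz nz oG; move: (#|[set _ | _ in _]%SET|) => k ek.
suff -> : k = n by [].
rewrite card_adm_pairs32 (card_Aut esG Zz nz oG sp) in ek.
rewrite (card_symplectic_set esG Zz nz oG sp) pe em -en in ek.
by apply/eqP; rewrite -(eqn_pmul2r (_ : 0 < m * 16)%N) ?muln_gt0 ?m0 ?ek.
Qed.

Lemma adm_A_generator (phi : P2 2 -> gT) : admissible_epi G phi ->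
  generator 'Z(G) (phi A12) /\ #[phi A12] = 2%N.
Proof.
move=> phiA; have -> : phi A12 = z := adm_A_central esG Zz nz phiA.
have oz : #[z] = 2%N.
  by apply: nt_prime_order; rewrite // (expgS _ 1) expg1 (zz Zz nz).
split=> //; rewrite /generator eq_sym finset.eqEcard cycle_subG (zZ Zz) /=.
by rewrite -[#|<[z]>|]/#[z] oz Zz cards2; case: (_ != _).
Qed.

End Counts.

Theorem corollary3p18 (gT : finGroupType) (G : {group gT}) :
  (forall (b : nat) (phi : P2 b -> gT),
     (2 <= b)%N -> admissible_epi G phi -> (32 <= #|G|)%N)
  /\ (#|G| = 32%N ->
      ((exists (b : nat) (phi : P2 b -> gT), (2 <= b)%N /\ admissible_epi G phi)
       <-> extraspecial G))
  /\ (extraspecial G -> #|G| = 32%N ->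
      (admissible_epi G : set (P2 2 -> gT)) #= `I_(1152 * 1920)%N
      /\ (forall phi : P2 2 -> gT, admissible_epi G phi ->
            generator 'Z(G) (phi A12) /\ #[phi A12] = 2%N))
  /\ (is_H5 G -> Aut_orbits 2 G #= `I_1920)
  /\ (is_G5 G -> Aut_orbits 2 G #= `I_1152).
Proof.
split; first by move=> b phi; apply: adm_card_ge32.
split.
  move=> oG; split=> [[b [phi [b2 phiA]]]|esG].
    exact: adm32_extraspecial phiA b2 oG.
  have [z [p [Zz nz sp]]] := extraspecial32_symplectic esG oG.
  have /card_gt0P[pq Tpq] : (0 < #|adm_pairs G|)%N.
    by rewrite (card_adm_pairs32 esG Zz nz oG sp) muln_gt0.
  by exists 2%N, (epi_of z pq); split=> //; apply: (epi_of_adm esG Zz nz oG Tpq).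
split.
  move=> esG oG; have [z [p [Zz nz sp]]] := extraspecial32_symplectic esG oG.
  split; last by move=> phi; apply: (adm_A_generator esG Zz nz).
  rewrite -(card_adm_pairs32 esG Zz nz oG sp).
  exact: (card_admissible esG Zz nz oG).
split.
  case/is_H5_symplectic=> z [p [esG oG Zz nz [sp ep]]].
  have e : (1920 * (72 * 16) = 1152 * 1920)%N by lia.
  exact: (card_Aut_orbits32 esG Zz nz oG sp ep count_basis_H5 isT e).
case/is_G5_symplectic=> z [p [esG oG Zz nz [sp ep]]].
have e : (1152 * (120 * 16) = 1152 * 1920)%N by lia.
exact: (card_Aut_orbits32 esG Zz nz oG sp ep count_basis_G5 isT e).
Qed.
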